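(* Let $\phi$ be a Legendre and 1-coercive dgf on $\mathbb R^n$, $X=\operatorname{dom}\phi$, and let $f:X\to\overline{\mathbb R}$ be proper, lsc, and $\phi$-prox-bounded with threshold $\lambda_f$. Fix $\lambda\in(0,\lambda_f)$ and consider the following statements: (a) $f+\lambda^{-1}\phi$ is convex. (b) $f=\mathrm{hull}_\lambda f$. (c) $\overleftarrow{\mathrm{prox}}_{\lambda f}\circ\nabla\phi^*$ is maximally monotone. (d) $\overleftarrow{\mathrm{prox}}_{\lambda f}\circ\nabla\phi^*$ is convex-valued. (e) $\operatorname{relint}\operatorname{conv}\operatorname{dom}f\subseteq\operatorname{dom}\partial f$ and $\partial f=\overleftarrow{\partial}_\lambda f$ on $\operatorname{int}X$. (f) $\operatorname{relint}\operatorname{conv}\operatorname{dom}f\cap\operatorname{int}X\subseteq\operatorname{dom}\overleftarrow{\partial}_\lambda f$. (g) $\operatorname{relint}\operatorname{conv}\operatorname{dom}f\subseteq\operatorname{dom}\partial f$ and $\overleftarrow{\mathrm{prox}}_{\lambda f}=(\nabla\phi+\lambda\partial f)^{-1}\circ\nabla\phi$. Then (g) $\Rightarrow$ (a) $\Leftrightarrow$ (b) $\Leftrightarrow$ (c) $\Leftrightarrow$ (d) $\Rightarrow$ (e) $\Rightarrow$ (f) always hold. The implication (f) $\Rightarrow$ (a) holds when $\operatorname{relint}\operatorname{conv}\operatorname{dom}f\subseteq\operatorname{int}X$, and so does (a) $\Rightarrow$ (g) if in addition $\operatorname{range}\overleftarrow{\mathrm{prox}}_{\lambda f}\subseteq\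operatorname{int}\operatorname{dom}\phi$.
   Context: $\overline{\mathbb R}=[-\infty,\infty]$. A distance-generating function (dgf) is a proper, lsc, convex $\phi:\mathbb R^n\to\overline{\mathbb R}$ differentiable on $Y=\operatorname{int}\operatorname{dom}\phi\neq\emptyset$. $\phi^*$ is its convex conjugate. $D_\phi(x,y)=\phi(x)-\phi(y)-\langle\nabla\phi(y),x-y\rangle$ if $y\in Y$, and $\infty$ otherwise. $\phi$ is Legendre if it is essentially smooth (differentiable on $Y\ne\emptyset$ with $\|\nabla\phi(x^k)\|\to\infty$ whenever $Y\ni x^k\to x\in\operatorname{bdry}\operatorname{dom}\phi$) and essentially strictly convex (strictly convex on every convex subset of $\operatorname{dom}\partial\phi$). $\phi$ is 1-coercive if $\liminf_{\|x\|\to\infty}\phi(x)/\|x\|=\infty$ (so that $\operatorname{dom}\phi^*=\mathbb R^n$). $f:X\to\overline{\mathbb R}$ is proper if not identically $\infty$ and never $-\infty$; lsc is meant relative to $X$; $\operatorname{dom}f=\{f<\infty\}$. For $h:X\to\overline{\mathbb R}$, with all points and limits in $X$: Fréchet subdifferential $\hat\partial h(x)=\{v:\liminf_{z\to x,z\ne x}\frac{h(z)-h(x)-\langle v,z-x\rangle}{\|z-x\|}\ge0\}$; limiting subdifferential $\partial h(x)=\{v:\exists (x^k,v^k)\in\operatorname{gph}\hat\partial h,\ (x^k,h(x^k),v^k)\to(x,h(x),v)\}$ if $h(x)<\infty$, and $\emptyset$ otherwise. For $\bar y\in Y$: $\overleftarrow{\mathrm{prox}}_{\lambda f}(\bar y)=\operatorname{argmin}_{x\in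 X}\{f(x)+\frac1\lambda D_\phi(x,\bar y)\}$, and $\overleftarrow{\mathrm{env}}_\lambda f(\bar y)$ is the corresponding infimum. For $g:Y\to\overline{\mathbb R}$ and $\bar x\in X$, $\overrightarrow{\mathrm{env}}_\lambda g(\bar x)=\inf_{y\in Y}\{g(y)+\frac1\lambda D_\phi(\bar x,y)\}$. $\mathrm{hull}_\lambda f=-\overrightarrow{\mathrm{env}}_\lambda(-\overleftarrow{\mathrm{env}}_\lambda f):X\to\overline{\mathbb R}$. $f$ is $\phi$-prox-bounded if $\overleftarrow{\mathrm{env}}_\lambda f(y)>-\infty$ for some $\lambda>0$, $y\in Y$; $\lambda_f$ is the supremum of all such $\lambda$. Left Bregman level proximal subdifferential: $\bar u\in\overleftarrow{\partial}_\lambda f(\bar x)$ iff $\bar x\in\operatorname{int}X$ and $f(x)\ge f(\bar x)+\langle\bar u,x-\bar x\rangle-\frac1\lambda D_\phi(x,\bar x)$ for all $x\in X$. Set-valued conventions: $\operatorname{dom}T=\{x:T(x)\ne\emptyset\}$, $\operatorname{range}T=\bigcup_xT(x)$, $T^{-1}(y)=\{x:y\in T(x)\}$; $\nabla\phi$ is defined on $Y=\operatorname{int}X$ only. $T$ is monotone if $\langle x-\bar x,y-\bar y\rangle\ge0$ for all $(x,y),(\bar x,\bar y)\in\operatorname{gph}T$, and maximally monotone if its graph is not strictly contained in the graph of another monotone operator. *)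

(* Defs.v *)
From HB Require Import structures.
From mathcomp Require Import all_boot all_order all_algebra.
From mathcomp Require Import all_classical all_reals all_analysis.
Set Implicit Arguments.
Unset Strict Implicit.
Unset Printing Implicit Defensive.
Import Order.TTheory GRing.Theory Num.Theory.
Import numFieldNormedType.Exports.
Local Open Scope classical_set_scope.
Local Open Scope ring_scope.

(* R^n is 'rV[R]_n. Its library topology is the usual one, but its library norm
   is the sup norm, so the Euclidean inner product and norm are defined here.
   A function X -> [-oo, +oo] on a subset X of R^n is a total function to \bar R
   together with X; every notion below only reads its values on X. *)

Section Euclidean.
Context {R : realType} {n : nat}.
Implicit Types (x y : 'rV[R]_n) (C : set 'rV[R]_n).

Definition dot x y : R := \sum_(i < n) x 0 i * y 0 i.

Definition enorm x : R := Num.sqrt (dot x x).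

Definition enorm_pinfty : set_system 'rV[R]_n :=
  filter_from [set: R] (fun M => [set x | M < enorm x]).

Definition boundary C : set 'rV[R]_n := closure C `\` C°.

Definition convex_hull C : set 'rV[R]_n := smallest (@convex_set R 'rV[R]_n) C.

Definition affine_set C :=
  forall x y (t : R), C x -> C y -> C (t *: x + (1 - t) *: y).

Definition aff C : set 'rV[R]_n := smallest affine_set C.

Definition relint C : set 'rV[R]_n :=
  [set x | C x /\ \forall z \near x, aff C z -> C z].

End Euclidean.

Section SetValued.
Context {U V W : Type}.

Definition svgraph (T : U -> set V) : set (U * V) := [set p | T p.1 p.2].
Definition svdom (T : U -> set V) : set U := [set x | T x !=set0].
Definition svrange (T : U -> set V) : set V := \bigcup_x T x.
Definition svinv (T : U -> set V) : V -> set U := fun y => [set x | T x y].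
Definition svcomp (S : V -> set W) (T : U -> set V) : U -> set W :=
  fun x => \bigcup_(y in T x) S y.

End SetValued.

Section Operators.
Context {R : realType} {n : nat}.
Local Notation V := 'rV[R]_n.
Implicit Types S T : V -> set V.

Definition svadd S T : V -> set V :=
  fun x => [set u + v | u in S x & v in T x].

Definition svscale (a : R) T : V -> set V := fun x => [set a *: v | v in T x].

Definition convex_valued T := forall x, @convex_set R V (T x).

Definition monotone_op T :=
  forall x y x' y', T x y -> T x' y' -> 0 <= dot (x - x') (y - y').

Definition maximally_monotone T :=
  monotone_op T /\
  forall S, monotone_op S -> ~ (svgraph T `<` svgraph S).

End Operators.

Section ExtendedFunctions.
Context {R : realType} {n : nat}.
Local Notation V := 'rV[R]_n.
Implicit Types (X C : set V) (h : V -> \bar R) (x y u v : V).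
Local Open Scope ereal_scope.

Definition edom h : set V := [set x | h x < +oo].

Definition proper_on X h :=
  (forall x, X x -> -oo < h x) /\ (exists2 x, X x & h x < +oo).

Definition lsc_on X h := @lower_semicontinuous (subspace X) R h.

Definition convex_on X h :=
  @convex_set R V X /\
  forall x y (t : R), X x -> X y -> (0 < t < 1)%R ->
    h (t *: x + (1 - t) *: y)%R <= t%:E * h x + (1 - t)%:E * h y.

Definition strictly_convex_on C h :=
  forall x y (t : R), C x -> C y -> x <> y -> (0 < t < 1)%R ->
    h (t *: x + (1 - t) *: y)%R < t%:E * h x + (1 - t)%:E * h y.

Definition conjugate h : V -> \bar R :=
  fun u => ereal_sup [set (dot u x)%:E - h x | x in [set: V]].

(* The row of partial derivatives of h; it represents the differential of h
   wherever h is finite and differentiable. *)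
Definition grad h y : V := (\row_i 'D_(delta_mx 0 i) (fine \o h) y)%R.

(* The gradient of h as an operator whose domain is the interior of dom h. *)
Definition nabla h : V -> set V :=
  fun y => [set u | (edom h)° y /\ u = grad h y].

(* The liminf is over z in X, z <> x; h x is required to be finite so that the
   difference quotient involves no indeterminate form. *)
Definition frechet_subdiff X h : V -> set V := fun x => [set v |
  [/\ X x, h x \is a fin_num
    & 0 <= limf_einf
        (fun z => (h z - h x - (dot v (z - x)%R)%:E) * ((enorm (z - x)%R)^-1)%:E)
        (within X x^')]].

Definition limiting_subdiff X h : V -> set V := fun x => [set v |
  [/\ X x, h x < +oo
    & exists (x_ v_ : nat -> V),
      [/\ forall k, frechet_subdiff X h (x_ k) (v_ k),
          x_ k @[k --> \oo] --> x,
          h (x_ k) @[k --> \oo] --> h x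
        & v_ k @[k --> \oo] --> v]]].

End ExtendedFunctions.

Section Bregman.
Context {R : realType} {n : nat}.
Local Notation V := 'rV[R]_n.
Variable phi : V -> \bar R.
Implicit Types (f g : V -> \bar R) (x y u : V) (lambda : R).
Local Open Scope ereal_scope.

Local Notation X := (edom phi).
Local Notation Y := ((edom phi)°).

Definition dgf :=
  [/\ proper_on setT phi, lower_semicontinuous phi, convex_on setT phi, Y !=set0
    & forall y, Y y -> differentiable (fine \o phi) y].

Definition essentially_smooth :=
  [/\ Y !=set0,
      forall y, Y y -> differentiable (fine \o phi) y
    & forall (x_ : nat -> V) x,
        (forall k, Y (x_ k)) -> boundary X x -> x_ k @[k --> \oo] --> x ->
        (enorm (grad phi (x_ k)))%:E @[k --> \oo] --> +oo].

Definition essentially_strictly_convex :=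
  forall C : set V, @convex_set R V C ->
    C `<=` svdom (limiting_subdiff setT phi) -> strictly_convex_on C phi.

Definition legendre := essentially_smooth /\ essentially_strictly_convex.

Definition one_coercive :=
  limf_einf (fun x => phi x * ((enorm x)^-1)%:E) enorm_pinfty = +oo.

Definition bregman x y : \bar R :=
  if y \in (Y : set V) then phi x - phi y - (dot (grad phi y) (x - y)%R)%:E else +oo.

Definition left_prox lambda f : V -> set V := fun y => [set x |
  [/\ Y y, X x
    & forall z, X z ->
        f x + lambda^-1%:E * bregman x y <= f z + lambda^-1%:E * bregman z y]].

(* Only meaningful at points y of Y. *)
Definition left_env lambda f y : \bar R :=
  ereal_inf [set f x + lambda^-1%:E * bregman x y | x in X].

(* Only meaningful at points x of X. *)
Definition right_env lambda g x : \bar R :=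
  ereal_inf [set g y + lambda^-1%:E * bregman x y | y in Y].

Definition hull lambda f x : \bar R :=
  - right_env lambda (fun y => - left_env lambda f y) x.

Definition prox_parameters f : set R :=
  [set lambda | (0 < lambda)%R /\ exists2 y, Y y & -oo < left_env lambda f y].

Definition prox_bounded f := prox_parameters f !=set0.

Definition prox_threshold f : \bar R :=
  ereal_sup [set lambda%:E | lambda in prox_parameters f].

Definition level_subdiff lambda f : V -> set V := fun x => [set u |
  Y x /\
  forall z, X z ->
    f x + (dot u (z - x)%R)%:E - lambda^-1%:E * bregman z x <= f z].

End Bregman.

(* Main.v *)
Require Import Defs.
From HB Require Import structures.
From mathcomp Require Import all_boot all_order all_algebra.
From mathcomp Require Import all_classical all_reals all_analysis.
From mathcomp Require Import ring lra.
Set Implicit Arguments.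
Unset Strict Implicit.
Unset Printing Implicit Defensive.
Import Order.TTheory GRing.Theory Num.Theory.
Import numFieldNormedType.Exports.
Local Open Scope classical_set_scope.
Local Open Scope ring_scope.

(** Put mu = 1 / lambda and let F be f + mu phi on X, extended by +oo to the
    whole space (shifted below). Since the Bregman distance to y is phi minus
    its affine minorant at y, every object of the theorem is a statement about
    global subgradients of F (supports F w x: the affine function of slope w
    through (x, F x) lies below F):
    - x is in the left prox of y iff mu grad phi(y) is a subgradient of F at x;
    - u is in the level subdifferential at x iff u + mu grad phi(x) is a
      subgradient of F at x, x being interior to X;
    - on X, the hull of f is the biconjugate of F minus mu phi.
    Because phi is Legendre and 1-coercive, grad phi maps Y onto the whole space
    and grad phi^* inverts it (nabla_conjugate), so that the operator in (c) and
    (d) is u |-> A (mu u), where A w is the set of maximizers of <w, .> - F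
    (svcomp_left_proxE). Because lambda is below the threshold, F dominates an
    affine function plus a positive multiple of phi; hence F is lower
    semicontinuous and supercoercive on the whole space, and A is nonempty
    valued, locally bounded, with closed graph.

    The core is supports_radial: if A w is convex and v is not in it, a
    hyperplane strictly separates v from A w, and by compactness it still
    separates v from A (w + t d) for small t, d being its normal. It has two
    uses. In supports_maximally_monotone it shows that no pair can be added to
    the graph of A when A is convex valued: (d) => (c). In
    regularized_conjugate_min it gives the first order condition for the
    minimizer w of F^*(w) + (s/2) |w|^2 - <w, x>: the point x - s w lies in A w,
    which bounds F (x - s w) by F^{**}(x). Letting s tend to 0 gives
    F x <= F^{**}(x), which is (d) => (b) (supports_le_biconjugate). The
    implications (b) => (a) => (d) and (c) => (d) are elementary.

    For (e), convexity of F turns local subgradients into global ones, and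
    grad phi has enough continuity to pass to the limit, so the limiting and
    level subdifferentials of f agree on the interior of X (limiting_level). At
    a relative interior point x of dom f, possibly on the boundary of X, convex
    functions are Lipschitz at x along the affine hull; thus f is calm at x, and
    the minimizers of f + (K/2) |. - x|^2 near x carry bounded Frechet
    subgradients, a limit of which is a limiting subgradient at x
    (relint_limiting_nonempty).

    For the converse directions, fix a point x0 in the relative interior of
    conv dom f and in Y. The level subgradients, which exist on the open segment
    from x0 to any convex combination m of points of dom f, give the convexity
    inequality on that segment, and lower semicontinuity transports it to m
    (level_epi_convex). Condition (g) supplies such an x0, as it forces every
    prox point into Y, and it turns limiting subgradients in Y into level ones
    (resolvent_level). *)

(** * Euclidean and sequential preliminaries *)

Section NormConvergence.

Lemma cvg_norm_near (R : realType) (W : normedModType R) (T : Type)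
    (F : set_system T) {FF : Filter F} (x_ : T -> W) (x : W) (e : R) :
  x_ k @[k --> F] --> x -> 0 < e -> \forall k \near F, `|x - x_ k| < e.
Proof. by move=> /cvgrPdist_lt cx e0; exact: cx. Qed.

Lemma ler_cvg (R : realType) (u v : nat -> R) (a b : R) :
  u k @[k --> \oo] --> a -> v k @[k --> \oo] --> b -> (forall k, u k <= v k) -> a <= b.
Proof.
move=> ca cb uv.
rewrite -(cvg_lim _ ca) // -(cvg_lim _ cb) //; apply: ler_lim.
- by apply/cvg_ex; exists a.
- by apply/cvg_ex; exists b.
- exact: nearW.
Qed.

End NormConvergence.

Section InnerProduct.
Context {R : realType} {n : nat}.
Local Notation V := 'rV[R]_n.
Implicit Types (x y z u v w d : V) (t : R).

Lemma dotC x y : dot x y = dot y x.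
Proof. by apply: eq_bigr => i _; rewrite mulrC. Qed.

Lemma dotDl x y z : dot (x + y) z = dot x z + dot y z.
Proof. by rewrite -big_split; apply: eq_bigr => i _; rewrite mxE mulrDl. Qed.

Lemma dotZl t x y : dot (t *: x) y = t * dot x y.
Proof. by rewrite /dot mulr_sumr; apply: eq_bigr => i _; rewrite mxE mulrA. Qed.

Lemma dotNl x y : dot (- x) y = - dot x y.
Proof. by rewrite -scaleN1r dotZl mulN1r. Qed.

Lemma dotDr x y z : dot x (y + z) = dot x y + dot x z.
Proof. by rewrite dotC dotDl !(dotC x). Qed.

Lemma dotZr t x y : dot x (t *: y) = t * dot x y.
Proof. by rewrite dotC dotZl (dotC y). Qed.

Lemma dotNr x y : dot x (- y) = - dot x y.
Proof. by rewrite dotC dotNl (dotC y). Qed.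

Lemma dot0r x : dot x 0 = 0.
Proof. by rewrite -(scale0r x) dotZr mul0r. Qed.

Definition dotE := (dotDl, dotDr, dotNl, dotNr, dotZl, dotZr).

Lemma dot_delta x i : dot x (delta_mx 0 i) = x 0 i.
Proof.
rewrite /dot (bigD1 i) //= big1 ?addr0; last first.
  by move=> j ji; rewrite mxE eqxx (negbTE ji) mulr0.
by rewrite mxE !eqxx mulr1.
Qed.

Lemma dot_ge0 x : 0 <= dot x x.
Proof. by apply: sumr_ge0 => i _; rewrite -expr2 sqr_ge0. Qed.

Lemma coord_le_norm x i : `|x 0 i| <= `|x|.
Proof.
by rewrite [leRHS]mx_normrE (le_bigmax _ (fun ij => `|x ij.1 ij.2|) (ord0, i)).
Qed.

Lemma norm_le_coord x c : 0 <= c -> (forall i, `|x 0 i| <= c) -> `|x| <= c.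
Proof.
move=> c0 H; rewrite [leLHS]mx_normrE; apply: bigmax_le => // -[i j] _ /=.
by rewrite ord1.
Qed.

Lemma normr_dot_le x y : `|dot x y| <= n%:R * (`|x| * `|y|).
Proof.
apply: le_trans (ler_norm_sum _ _ _) _.
have -> : n%:R * (`|x| * `|y|) = \sum_(i < n) (`|x| * `|y|).
  by rewrite sumr_const card_ord mulr_natl.
by apply: ler_sum => i _; rewrite normrM ler_pM ?coord_le_norm.
Qed.

Lemma sqr_norm_le_dot x : `|x| ^+ 2 <= dot x x.
Proof.
rewrite -[dot x x]sqr_sqrtr ?dot_ge0 // ler_pXn2r ?nnegrE ?sqrtr_ge0 //.
apply: norm_le_coord; first exact: sqrtr_ge0.
move=> i; rewrite -sqrtr_sqr ler_wsqrtr // expr2 /dot (bigD1 i) //= lerDl.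
by apply: sumr_ge0 => j _; rewrite -expr2 sqr_ge0.
Qed.

Lemma norm_le_enorm x : `|x| <= enorm x.
Proof. by rewrite -[`|x|]ger0_norm // -sqrtr_sqr ler_wsqrtr // sqr_norm_le_dot. Qed.

Lemma enorm_ge0 x : 0 <= enorm x.
Proof. exact: sqrtr_ge0. Qed.

Lemma enorm_le_norm x : enorm x <= n.+1%:R * `|x|.
Proof.
rewrite -[leRHS]ger0_norm ?mulr_ge0 // -sqrtr_sqr ler_wsqrtr //.
apply: le_trans (ler_norm _) (le_trans (normr_dot_le _ _) _).
rewrite exprMn -[`|x| * _]expr2 ler_wpM2r ?sqr_ge0 // expr2 -natrM ler_nat.
by rewrite (leq_trans (leqnSn n)) // leq_pmulr.
Qed.

Lemma enorm_eq0 x : enorm x = 0 -> x = 0.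
Proof. by move=> e0; apply/normr0_eq0/eqP; rewrite eq_le normr_ge0 -e0 norm_le_enorm. Qed.

Lemma dot_eq0 x : dot x x <= 0 -> x = 0.
Proof.
move=> h; apply/normr0_eq0/eqP; rewrite -sqrf_eq0 eq_le sqr_ge0 andbT.
exact: le_trans (sqr_norm_le_dot x) h.
Qed.

Lemma cvg_coord (T : Type) (F : set_system T) {FF : Filter F} (x_ : T -> V) x i :
  x_ k @[k --> F] --> x -> x_ k 0 i @[k --> F] --> x 0 i.
Proof.
move=> cx; apply/cvgrPdist_lt => e e0.
apply: filterS (cvg_norm_near cx e0) => k; apply: le_lt_trans.
by have := coord_le_norm (x - x_ k) i; rewrite !mxE.
Qed.

Lemma cvg_dot (T : Type) (F : set_system T) {FF : Filter F} (x_ y_ : T -> V) x y :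
  x_ k @[k --> F] --> x -> y_ k @[k --> F] --> y ->
  dot (x_ k) (y_ k) @[k --> F] --> dot x y.
Proof.
move=> cx cy; rewrite /dot; apply: cvg_big => [|i _]; first exact: add_continuous.
by apply: cvgM; exact: cvg_coord.
Qed.

End InnerProduct.

Section Sequences.
Context {R : realType}.

Lemma near_extract (P : nat -> Prop) :
  (\forall k \near \oo, P k) -> exists N, forall k, P (N + k)%N.
Proof.
by case=> N _ NP; exists N => k; apply: NP; rewrite /= leq_addr.
Qed.

Lemma geq_id_cvgny (h : nat -> nat) : (forall k, k <= h k)%N ->
  h k @[k --> \oo] --> \oo.
Proof.
by move=> hk A [N _ NA]; exists N => // k /= Nk; apply/NA/(leq_trans Nk).
Qed.

(** The extraction only satisfies k <= h k, which is all that convergence needs: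
    the terms are picked one by one from the tails near a cluster point. *)
Lemma bolzano_weierstrass n (z_ : nat -> 'rV[R]_n) (c : R) :
  (forall k, `|z_ k| <= c) ->
  exists (h : nat -> nat) (z : 'rV[R]_n),
    (forall k, k <= h k)%N /\ z_ (h k) @[k --> \oo] --> z.
Proof.
move=> zc; pose A := [set z : 'rV[R]_n | `|z| <= c].
have cA : compact A.
  apply: bounded_closed_compact.
    exists c; split; first exact: num_real.
    by move=> e ce z /= zc'; rewrite (le_trans zc') // ltW.
  have -> : A = [eta (fun z => `|z|)] @^-1` [set r | r <= c] by [].
  apply: closed_comp; last exact: closed_le.
  by move=> z _; exact: norm_continuous.
have zA : (z_ @ \oo) A by exists 0%N => // k _; exact: zc.
have [z [_ clz]] := cA (z_ @ \oo) _ zA.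
have /choice[h hP] k : exists i, (k <= i)%N /\ `|z - z_ i| < harmonic k.
  have [||y [[i]]] := clz [set z_ i | i in [set i | (k <= i)%N]] (ball z (harmonic k)).
  - by exists k => // i /= ki; exists i.
  - by apply: nbhsx_ballx; rewrite invr_gt0.
  by move=> /= ki <-; rewrite -ball_normE /= => zi; exists i.
exists h, z; split; first by move=> k; case: (hP k).
apply/cvgrPdist_lt => e e0.
apply: filterS (cvg_norm_near (@cvg_harmonic R) e0) => k.
rewrite sub0r normrN => he; apply: lt_trans (proj2 (hP k)) _.
exact: le_lt_trans (ler_norm _) he.
Qed.

End Sequences.

(** * Functions seen through their epigraphs, and their global subgradients *)

Section RealLemmas.
Context {R : realType}.
Implicit Types (a b c s r t : R).

(** First order conditions are obtained by dividing by t and letting it tend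
    to 0; this is the limit step. *)
Lemma le0_small a b : (forall t, 0 < t < 1 -> a <= t * b) -> a <= 0.
Proof.
move=> h; rewrite leNgt; apply/negP => a0.
have b0 : 0 < b.
  by have := h (2^-1); rewrite invr_gt0 ltr0n invf_lt1 ?ltr1n //= => /(_ isT); nra.
have d0 : 0 < a + 2 * b by nra.
have := h (a / (a + 2 * b)).
rewrite divr_gt0 //= ltr_pdivrMr // mul1r.
have /[swap]/[apply] : a < a + 2 * b by nra.
rewrite mulrAC ler_pdivlMr //; nra.
Qed.

Lemma quadratic_bound s b c r : 0 < s -> 0 <= r -> s * r ^+ 2 <= b + c * r ->
  r <= 1 + (`|b| + `|c|) / s.
Proof.
move=> s0 r0 h; have bb := ler_norm b; have cc := ler_norm c.
have b0 := normr_ge0 b; have c0 := normr_ge0 c.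
have [r1|r1] := leP r 1; first by rewrite (le_trans r1) // lerDl divr_ge0 // ?addr_ge0 // ltW.
suff : r <= (`|b| + `|c|) / s by move/le_trans; apply; rewrite lerDr.
rewrite ler_pdivlMr //; nra.
Qed.

Lemma cvg_harmonicS : (k.+2%:R : R)^-1 @[k --> \oo] --> (0 : R).
Proof.
have := @cvg_harmonic R; rewrite -(cvg_shiftS).
exact.
Qed.

End RealLemmas.

Section EpigraphCalculus.
Context {R : realType} {n : nat}.
Local Notation V := 'rV[R]_n.
Implicit Types (G : V -> \bar R) (x y z w v d : V) (a b c t : R).

(** Stated with real upper bounds of the values, which also covers values that
    are infinite. *)
Definition seq_lsc G := forall (z_ : nat -> V) z (a_ : nat -> R) a,
  z_ k @[k --> \oo] --> z -> a_ k @[k --> \oo] --> a ->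
  (forall k, (G (z_ k) <= (a_ k)%:E)%E) -> (G z <= a%:E)%E.

(** Convexity of the epigraph, which avoids sums of opposite infinities. *)
Definition epi_convex G := forall x y a b t, 0 < t < 1 ->
  (G x <= a%:E)%E -> (G y <= b%:E)%E ->
  (G (t *: x + (1 - t) *: y)%R <= (t * a + (1 - t) * b)%:E)%E.

Definition supercoercive G := forall K, exists c, forall z b,
  (G z <= b%:E)%E -> K * `|z| - c <= b.

Definition coercive_lsc G := [/\ forall z, (-oo < G z)%E,
  exists x0 g0, (G x0 <= g0%:E)%E, seq_lsc G & supercoercive G].

(** w is a global (convex) subgradient of G at x; equivalently, x maximizes
    <w, .> - G. *)
Definition supports G w x := exists2 g, G x = g%:E &
  forall z b, (G z <= b%:E)%E -> g + dot w (z - x) <= b.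

Definition segment_closed (A : set V) := forall x y t, 0 < t < 1 ->
  A x -> A y -> A (t *: x + (1 - t) *: y).

(** A single cluster point of almost minimizing points works for all levels a
    at once; that is why a is quantified after z. *)
Lemma cluster_min G (a_ : nat -> R) g0 c : seq_lsc G ->
  (forall z, (G z <= g0%:E)%E -> `|z| <= c) ->
  (forall k, a_ k <= g0) -> (forall k, exists z, (G z <= (a_ k)%:E)%E) ->
  exists z, forall a, (\forall k \near \oo, a_ k <= a) -> (G z <= a%:E)%E.
Proof.
move=> lscG Gc ag0 /choice[z_ Gz].
have [k|h [z [hk hz]]] := @bolzano_weierstrass R n z_ c.
  by apply: Gc; apply: le_trans (Gz k) _; rewrite lee_fin.
exists z => a /near_extract[N Na].
apply: (lscG (fun k => z_ (h (k + N)%N)) z (fun=> a) a).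
- by rewrite (@cvg_shiftn N _ (fun k => z_ (h k))).
- exact: cvg_cst.
move=> k; apply: le_trans (Gz _) _; rewrite lee_fin.
have le_h : (N <= h (k + N))%N by rewrite (leq_trans _ (hk _)) // leq_addl.
by rewrite -(subnKC le_h); exact: Na.
Qed.

(** The direct method. The bound on the sublevel set replaces compactness of
    the domain, and also excludes an infimum equal to -oo. *)
Lemma attains_min G x0 g0 c : seq_lsc G -> (forall z, (-oo < G z)%E) ->
  (G x0 <= g0%:E)%E -> (forall z, (G z <= g0%:E)%E -> `|z| <= c) ->
  exists x, exists2 g, G x = g%:E & forall z b, (G z <= b%:E)%E -> g <= b.
Proof.
move=> lscG Gny Gx0 Gc; pose S := [set b | exists z, (G z <= b%:E)%E].
have S0 : S !=set0 by exists g0, x0.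
have [hS|/forallNP nS] := pselect (exists m, lbound S m); last first.
  have Sg k : exists z, (G z <= (g0 - k%:R)%:E)%E.
    have /existsNP[b /not_implyP[[z Gz] /negP]] := nS (g0 - k%:R).
    rewrite -ltNge => bk; exists z; apply: le_trans Gz _.
    by rewrite lee_fin ltW.
  have [|z Gz] := cluster_min lscG Gc _ Sg; first by move=> k; rewrite lerBlDr lerDl.
  have Gza a : (G z <= a%:E)%E.
    apply: Gz; exists (Num.truncn `|g0 - a|).+1 => // k /= ka.
    have := truncnS_gt `|g0 - a|; have := ler_norm (g0 - a).
    have : (Num.truncn `|g0 - a|).+1%:R <= k%:R :> R by rewrite ler_nat.
    lra.
  have := Gny z; case: (G z) Gza => [r| |] // H _.
    by have := H (r - 1); rewrite lee_fin; lra.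
  by have := H 0; rewrite leye_eq.
have hiS : has_inf S by [].
pose m := inf S.
have Sm b : S b -> m <= b by move=> Sb; apply: ge_inf => //; case: hiS.
pose a_ k := Num.min g0 (m + harmonic k).
have Sa k : exists z, (G z <= (a_ k)%:E)%E.
  rewrite /a_; case: leP => _; first by exists x0.
  have h0 : 0 < harmonic k :> R by rewrite invr_gt0.
  have [b [z Gz] bm] := inf_adherent h0 hiS.
  by exists z; apply: le_trans Gz _; rewrite lee_fin ltW.
have [|z Gz] := cluster_min lscG Gc _ Sa; first by move=> k; rewrite ge_min lexx.
have Gzm : (G z <= m%:E)%E.
  apply/lee_addgt0Pr => e e0; rewrite -EFinD; apply: Gz.
  apply: filterS (cvg_norm_near (@cvg_harmonic R) e0) => k.
  rewrite sub0r normrN => he; rewrite /a_ ge_min lerD2l.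
  by rewrite (le_trans (ler_norm _) (ltW he)) orbT.
exists z; have := Gny z; case Gze : (G z) => [g| |] // _; last by rewrite Gze in Gzm.
exists g => // y b Gyb; apply: le_trans (Sm b _); last by exists y.
by rewrite -lee_fin -Gze.
Qed.

Lemma supports_ineq G w x z g b : supports G w x -> G x = g%:E ->
  (G z <= b%:E)%E -> g + dot w (z - x) <= b.
Proof. by move=> [g' -> H] [<-]; exact: H. Qed.

(** Supercoercivity makes G - <w, .> supercoercive too, so it has a minimizer,
    and being a minimizer is the same as supporting G with slope w. *)
Lemma supports_exists G w : coercive_lsc G -> exists x, supports G w x.
Proof.
move=> [Gny [x0 [g0 Gx0]] lscG scG].
pose H z := (G z - (dot w z)%:E)%E.
have HE z b : (H z <= b%:E)%E = (G z <= (b + dot w z)%:E)%E.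
  by rewrite /H leeBlDr // EFinD.
(* n |w| bounds the slope of <w, .> for the sup norm. *)
have [c Gc] := scG (n%:R * `|w| + 1).
have [||||x [g Hx minx]] := @attains_min H x0 (g0 - dot w x0) (g0 - dot w x0 + c).
- move=> z_ z a_ a cz ca Hz; rewrite HE.
  apply: (lscG z_ z (fun k => a_ k + dot w (z_ k))) => //; last by move=> k; rewrite -HE.
  by apply: cvgD => //; apply: cvg_dot => //; exact: cvg_cst.
- by move=> z; rewrite /H; have := Gny z; case: (G z) => // r _; rewrite -EFinB ltNyr.
- by rewrite HE subrK.
- move=> z; rewrite HE => /Gc.
  by have := ler_norm (dot w z); have := normr_dot_le w z; lra.
have Gx : G x = (g + dot w x)%:E.
  move: Hx; rewrite /H; have := Gny x; case: (G x) => [r| |] // _ [<-].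
  by rewrite subrK.
exists x, (g + dot w x) => // z b Gz; rewrite !dotE.
have := minx z (b - dot w z); rewrite HE subrK => /(_ Gz); lra.
Qed.

(** The inequality at a fixed epigraph point (y, b) bounds G (z_ k) from above,
    so lower semicontinuity applies without continuity of G along z_. *)
Lemma supports_closed G (w_ z_ : nat -> V) w z : coercive_lsc G ->
  w_ k @[k --> \oo] --> w -> z_ k @[k --> \oo] --> z ->
  (forall k, supports G (w_ k) (z_ k)) -> supports G w z.
Proof.
move=> [Gny [x0 [g0 Gx0]] lscG _] cw cz sup.
have Gz y b : (G y <= b%:E)%E -> (G z <= (b - dot w (y - z))%:E)%E.
  move=> Gy; apply: (lscG z_ z (fun k => b - dot (w_ k) (y - z_ k))) => //.
    apply: cvgB; first exact: cvg_cst.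
    by apply: cvg_dot => //; apply: cvgB => //; exact: cvg_cst.
  move=> k; have [g -> H] := sup k; rewrite lee_fin.
  by have := H y b Gy; lra.
have := Gny z; case Gze : (G z) => [g| |] // _; last first.
  by have := Gz _ _ Gx0; rewrite Gze.
exists g => // y b Gy; have := Gz _ _ Gy; rewrite Gze lee_fin; lra.
Qed.

(** Supercoercivity with a slope larger than that of w beats the linear term. *)
Lemma supports_bounded G r : coercive_lsc G ->
  exists c, forall w z, `|w| <= r -> supports G w z -> `|z| <= c.
Proof.
move=> [Gny [x0 [g0 Gx0]] lscG scG].
(* The slope n r is the largest one of <w, .> for |w| <= r. *)
have [c Gc] := scG (n%:R * r + 1).
exists (g0 + c + n%:R * r * `|x0|) => w z wr [g Gz H].
have := H _ _ Gx0; have := Gc z g; rewrite Gz lexx => /(_ isT).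
rewrite !dotE; have n0 : 0 <= n%:R :> R by [].
have := ler_norm (- dot w x0); have := ler_norm (dot w z).
have := normr_dot_le w x0; have := normr_dot_le w z; rewrite normrN.
have : n%:R * (`|w| * `|z|) <= n%:R * r * `|z| by rewrite -mulrA !ler_wpM2l ?ler_wpM2r.
have : n%:R * (`|w| * `|x0|) <= n%:R * r * `|x0| by rewrite -mulrA !ler_wpM2l ?ler_wpM2r.
lra.
Qed.

(** The obtuse angle property of the projection on a closed convex set, used
    below as a separation theorem. *)
Lemma nearest_point (A : set V) z0 v : A z0 -> segment_closed A ->
  (forall (z_ : nat -> V) z, (forall k, A (z_ k)) -> z_ k @[k --> \oo] --> z -> A z) ->
  exists2 p, A p & forall z, A z -> dot (v - p) (z - p) <= 0.
Proof.
move=> Az0 cA clA.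
pose G z : \bar R := if z \in A then (dot (z - v) (z - v))%:E else +oo%E.
have GE z b : (G z <= b%:E)%E <-> A z /\ dot (z - v) (z - v) <= b.
  rewrite /G; case: ifPn => [|/negP]; rewrite inE => Az.
    by rewrite lee_fin; split=> [//|[]].
  by rewrite leye_eq; split=> // -[].
set g0 := dot (z0 - v) (z0 - v).
have [||||p [g Gp minp]] := @attains_min G z0 g0 (1 + g0 + `|v|).
- move=> z_ z a_ a cz ca Gz; apply/GE; split.
    by apply: (clA z_ z) => // k; have /GE[] := Gz k.
  have cd : dot (z_ k - v) (z_ k - v) @[k --> \oo] --> dot (z - v) (z - v).
    by apply: cvg_dot; apply: cvgB => //; exact: cvg_cst.
  apply: (ler_cvg cd ca) => k.
  by have /GE[] := Gz k.
- by move=> z; rewrite /G; case: ifP => // _; rewrite ltNyr.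
- by apply/GE.
- move=> z /GE[_ zg]; have := ler_normD (z - v) v; rewrite subrK.
  have := sqr_norm_le_dot (z - v); have := normr_ge0 (z - v); nra.
have Gpg : (G p <= g%:E)%E by rewrite Gp.
have [Ap _] := iffLR (GE p g) Gpg.
exists p => // z Az.
have gE : g = dot (p - v) (p - v) by move: Gp; rewrite /G mem_set // => -[].
suff : 2 * dot (v - p) (z - p) <= 0 by lra.
apply: (@le0_small _ _ (dot (z - p) (z - p))) => t t01.
have := minp (t *: z + (1 - t) *: p) _ (iffRL (GE _ _) (conj (cA _ _ _ t01 Az Ap) (lexx _))).
rewrite gE.
have -> : t *: z + (1 - t) *: p - v = (p - v) + t *: (z - p).
  by apply/rowP => i; rewrite !mxE; ring.
have -> : v - p = - (p - v) by rewrite opprB.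
move: (p - v) (z - p) => q e; rewrite !dotE (dotC e q).
case/andP: t01; nra.
Qed.

(** A convex-valued subgradient map is determined by its behaviour along rays
    leaving w. If v were outside the convex compact set of x supported by w,
    with nearest point p, take d = v - p: points z supported by w + t d with
    <z, d> >= <v, d> - t c accumulate at a point supported by w that lies beyond
    the hyperplane through p, which is impossible. *)
Lemma supports_radial G w v : coercive_lsc G -> segment_closed (supports G w) ->
  (forall d, exists c, forall t, 0 < t < 1 ->
     exists2 z, supports G (w + t *: d) z & dot v d - t * c <= dot z d) ->
  supports G w v.
Proof.
move=> cG cA H.
have [z0 Az0] := supports_exists w cG.
have [|p Ap Hp] := nearest_point v Az0 cA.
  by move=> z_ z Az cz; apply: (supports_closed cG _ cz Az); exact: cvg_cst.
have [c Hc] := H (v - p).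
have t01 k : 0 < (k.+2%:R : R)^-1 < 1 by rewrite invr_gt0 ltr0n invf_lt1 ?ltr1n.
have /choice[z_ Hz] k : exists z, supports G (w + k.+2%:R^-1 *: (v - p)) z /\
    dot v (v - p) - k.+2%:R^-1 * c <= dot z (v - p).
  by have [z ? ?] := Hc _ (t01 k); exists z.
have [M HM] := supports_bounded (`|w| + `|v - p|) cG.
have [k|h [z [hk cz]]] := @bolzano_weierstrass R n z_ M.
  apply: (HM (w + k.+2%:R^-1 *: (v - p))); last by case: (Hz k).
  rewrite (le_trans (ler_normD _ _)) // lerD2l normrZ gtr0_norm; last by case/andP: (t01 k).
  by rewrite ler_piMl // ltW //; case/andP: (t01 k).
have ct : ((h k).+2%:R : R)^-1 @[k --> \oo] --> (0 : R).
  exact: (cvg_comp _ _ (geq_id_cvgny hk) (@cvg_harmonicS R)).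
have Az : supports G w z.
  apply: (supports_closed (w_ := fun k => w + (h k).+2%:R^-1 *: (v - p)) cG _ cz) => [|k]; last by case: (Hz (h k)).
  rewrite -[X in _ --> X]addr0 -(scale0r (v - p)); apply: cvgD; first exact: cvg_cst.
  by apply: cvgZr_tmp.
suff vp : v - p = 0 by rewrite -(subrK p v) vp add0r.
apply: dot_eq0; have := Hp z Az.
suff : dot v (v - p) <= dot z (v - p) by rewrite !dotE (dotC p v) (dotC z p) (dotC z v); lra.
have cl : dot v (v - p) - (h k).+2%:R^-1 * c @[k --> \oo] --> dot v (v - p).
  rewrite -[X in _ --> X]subr0 -(mul0r c); apply: cvgB; first exact: cvg_cst.
  by apply: cvgM => //; exact: cvg_cst.
have cr : dot (z_ (h k)) (v - p) @[k --> \oo] --> dot z (v - p).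
  by apply: cvg_dot => //; exact: cvg_cst.
by apply: (ler_cvg cl cr) => k; case: (Hz (h k)).
Qed.

End EpigraphCalculus.

(** * Biconjugation through convex-valued subgradient maps *)

Section Biconjugation.
Context {R : realType} {n : nat}.
Local Notation V := 'rV[R]_n.
Implicit Types (G : V -> \bar R) (x y z u w v d : V) (a b c t : R).

Definition fconj G w : R := fine (conjugate G w).

Lemma conjugate_supports G w x g : (forall z, (-oo < G z)%E) ->
  supports G w x -> G x = g%:E -> conjugate G w = (dot w x - g)%:E.
Proof.
move=> Gny [g' Gx H] Gxg; move: Gxg; rewrite Gx => -[<-].
apply/eqP; rewrite eq_le; apply/andP; split; last first.
  by apply: ereal_sup_ubound; exists x => //; rewrite Gx EFinB.
apply: ge_ereal_sup => _ [z _ <-].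
have := Gny z; case Gz : (G z) => [b| |] // _; last by rewrite leNye.
have := H z b; rewrite Gz lexx => /(_ isT); rewrite -EFinB lee_fin !dotE; lra.
Qed.

Lemma fconj_supports G w x g : (forall z, (-oo < G z)%E) ->
  supports G w x -> G x = g%:E -> fconj G w = dot w x - g.
Proof. by move=> Gny sx Gx; rewrite /fconj (conjugate_supports Gny sx Gx). Qed.

Lemma conjugateE G w : coercive_lsc G -> conjugate G w = (fconj G w)%:E.
Proof.
move=> cG; have [x sx] := supports_exists w cG; have [Gny _ _ _] := cG.
by have [g Gx _] := sx; rewrite /fconj (conjugate_supports Gny sx Gx).
Qed.

Lemma fenchel_young G w z b : coercive_lsc G -> (G z <= b%:E)%E ->
  dot w z - b <= fconj G w.
Proof.
move=> cG Gz; have [x sx] := supports_exists w cG; have [Gny _ _ _] := cG.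
have [g Gx _] := sx; rewrite (fconj_supports Gny sx Gx).
by have := supports_ineq sx Gx Gz; rewrite !dotE; lra.
Qed.

(** G is at most its biconjugate on X, the biconjugate being described by its
    real upper bounds. *)
Definition le_biconjugate_on (X : set V) G := forall x a, X x ->
  (forall w, dot w x - fconj G w <= a) -> (G x <= a%:E)%E.

(** The dual form of the Moreau regularization. A minimizer w of
    G^*(w) + (s/2) |w|^2 - <w, x> satisfies x - s w in the subdifferential of
    G^* at w; convexity of the set of maximizers puts x - s w in that set itself
    instead of only in its convex hull. *)
Lemma regularized_conjugate_min G x a s : coercive_lsc G ->
  (forall w, segment_closed (supports G w)) ->
  (forall w, dot w x - fconj G w <= a) -> 0 < s ->
  exists w, exists2 g, G (x - s *: w) = g%:E & g + s * dot w w <= a.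
Proof.
move=> cG cA xa s0; have [Gny [x0 [g0 Gx0]] lscG scG] := cG.
pose H w : \bar R := (fconj G w + s / 2 * dot w w - dot w x)%:E.
have s2 : 0 < s / 2 by rewrite divr_gt0.
pose b0 := fconj G 0 + s / 2 * dot (0 : V) 0 - dot (0 : V) x.
have [||||w [h Hw minw]] := @attains_min R n H 0 b0
    (1 + (`|b0 + g0| + `|n%:R * `|x - x0| |) / (s / 2)).
- move=> w_ w a_ a' cw ca Hk; rewrite lee_fin.
  have [z sz] := supports_exists w cG; have [g Gz _] := sz.
  rewrite (fconj_supports Gny sz Gz).
  have cl : dot (w_ k) z - g + s / 2 * dot (w_ k) (w_ k) - dot (w_ k) x @[k --> \oo] -->
      dot w z - g + s / 2 * dot w w - dot w x.
    apply: cvgB; last by apply: cvg_dot => //; exact: cvg_cst.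
    apply: cvgD; first by apply: cvgB; [apply: cvg_dot => //|]; exact: cvg_cst.
    by apply: cvgM; [exact: cvg_cst|exact: cvg_dot].
  apply: (ler_cvg cl ca) => k.
  have := Hk k; rewrite lee_fin; have : (G z <= g%:E)%E by rewrite Gz.
  move=> /(fenchel_young (w_ k) cG); lra.
- by move=> z; rewrite ltNyr.
- by [].
- move=> z; rewrite lee_fin => Hz; apply: quadratic_bound => //.
  have := ler_wpM2l (ltW s2) (sqr_norm_le_dot z).
  have := ler_norm (dot z (x - x0)); have := normr_dot_le z (x - x0).
  have := fenchel_young z cG Gx0; rewrite dotDr dotNr; lra.
have {minw} minw d t : dot w w * (s / 2) + fconj G w - dot w x <=
   fconj G (w + t *: d) + s / 2 * dot (w + t *: d) (w + t *: d) - dot (w + t *: d) x.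
  by have := minw (w + t *: d) _ (lexx _); case: Hw => <-; lra.
pose v := x - s *: w.
have sv : supports G w v.
  apply: supports_radial => // d; exists (s / 2 * dot d d) => t /andP[t0 t1].
  (* A maximizer z at w + t d bounds the increase of the conjugate by t <z, d>;
     minimality of w then bounds <z, d> from below. *)
  have [z sz] := supports_exists (w + t *: d) cG; exists z => //.
  have [g Gz _] := sz; rewrite -(ler_pM2l t0).
  have := minw d t; rewrite (fconj_supports Gny sz Gz).
  have : (G z <= g%:E)%E by rewrite Gz.
  move=> /(fenchel_young w cG).
  rewrite /v !dotE (dotC d w) (dotC d x) (dotC d z).
  rewrite (dotC w d) (dotC w x); lra.
exists w; have [g Gv _] := sv; exists g => //.
have := xa w; rewrite (fconj_supports Gny sv Gv) /v !dotE; lra.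
Qed.

(** As s tends to 0 the points x - s w of the previous lemma converge to x,
    because s |w|^2 is bounded by a minus a lower bound of G, while their values
    stay below a. *)
Lemma supports_le_biconjugate G X : coercive_lsc G ->
  (forall w, segment_closed (supports G w)) -> le_biconjugate_on X G.
Proof.
move=> cG cA x a _ xa; have [_ _ lscG scG] := cG.
have [c Gc] := scG 0.
have /choice[w_ Hw] k : exists w, exists2 g, G (x - (k.+2%:R^-1 : R) *: w) = g%:E &
    g + k.+2%:R^-1 * dot w w <= a.
  by apply: regularized_conjugate_min => //; rewrite invr_gt0.
pose s k : R := k.+2%:R^-1.
have s0 k : 0 < s k by rewrite invr_gt0.
apply: (lscG (fun k => x - s k *: w_ k) x (fun=> a) a); last first.
- move=> k; have [g Gk gk] := Hw k; rewrite Gk lee_fin.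
  by rewrite (le_trans _ gk) // lerDl mulr_ge0 ?dot_ge0 // ltW ?s0.
- exact: cvg_cst.
have bnd k : `|s k *: w_ k| ^+ 2 <= s k * (a + c).
  have [g Gk gk] := Hw k.
  have := Gc (x - s k *: w_ k) g; rewrite Gk lexx => /(_ isT).
  rewrite mul0r sub0r => cg; apply: le_trans (sqr_norm_le_dot _) _.
  rewrite dotZl dotZr ler_pM2l //; apply: (le_trans (y := a - g)).
    by rewrite lerBrDl.
  by rewrite lerD2l lerNl.
rewrite -[X in _ --> X]subr0; apply: cvgB; first exact: cvg_cst.
apply/cvgrPdist_lt => e e0.
have cs : s k * (a + c) @[k --> \oo] --> (0 : R).
  by rewrite -(mul0r (a + c)); apply: cvgM; [exact: cvg_harmonicS|exact: cvg_cst].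
have e20 : 0 < e ^+ 2 by rewrite exprn_gt0.
apply: filterS (cvg_norm_near cs e20) => k; rewrite !sub0r !normrN => ek.
rewrite -(ltr_pXn2r (n := 2)) ?nnegrE ?(ltW e0) //.
apply: le_lt_trans (bnd k) _; exact: le_lt_trans (ler_norm _) ek.
Qed.

Lemma epi_convex_supports G w : (forall z, (-oo < G z)%E) -> epi_convex G ->
  segment_closed (supports G w).
Proof.
move=> Gny cG x y t t01 [g Gx Hx] [g' Gy Hy].
have : (G (t *: x + (1 - t) *: y)%R <= (t * g + (1 - t) * g')%:E)%E.
  by apply: cG => //; rewrite ?Gx ?Gy.
set m := _ + _; have := Gny m; case Gm : (G m) => [h| |] // _.
rewrite lee_fin => hg; exists h => // z b Gz.
have := Hx z b Gz; have := Hy z b Gz; rewrite /m !dotE => A B.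
case/andP: t01 => t0 t1; nra.
Qed.

(** A supremum of affine functions is convex. *)
Lemma le_biconjugate_epi_convex G X : (forall x a, (G x <= a%:E)%E -> X x) ->
  coercive_lsc G -> segment_closed X -> le_biconjugate_on X G -> epi_convex G.
Proof.
move=> GX cG cX H x y a b t t01 Gx Gy.
apply: H => [|w]; first by apply: cX => //; [exact: GX Gx|exact: GX Gy].
have := fenchel_young w cG Gx; have := fenchel_young w cG Gy; rewrite !dotE.
case/andP: t01 => t0 t1; nra.
Qed.

End Biconjugation.

(** * Maximal monotonicity of the subgradient map *)

Section MaximalMonotonicity.
Context {R : realType} {n : nat}.
Local Notation V := 'rV[R]_n.
Implicit Types (G : V -> \bar R) (T : V -> set V) (x y z u w v d : V) (a b c t : R).

(** Membership in T u is cut out by the linear inequalities expressing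
    monotonicity with the rest of the graph, so adding the pair (u, m) keeps
    the operator monotone when m is between two points of T u. *)
Lemma maximal_segment_closed T u : maximally_monotone T -> segment_closed (T u).
Proof.
move=> [monT maxT] x y t t01 Tx Ty.
set m := t *: x + _.
pose S u' z := T u' z \/ (u' = u /\ z = m).
have mm u' z : T u' z -> 0 <= dot (u - u') (m - z).
  move=> Tz; have := monT _ _ _ _ Tx Tz; have := monT _ _ _ _ Ty Tz.
  have -> : m - z = t *: (x - z) + (1 - t) *: (y - z).
    by apply/rowP => i; rewrite !mxE; ring.
  by rewrite [dot _ (_ *: _ + _)]dotDr !dotZr => A B; case/andP: t01 => t0 t1; nra.
have monS : monotone_op S.
  move=> u1 z1 u2 z2 [T1|[-> ->]] [T2|[-> ->]].
  - exact: monT.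
  - by have := mm _ _ T1; rewrite !dotE; lra.
  - exact: mm.
  - by rewrite !subrr dot0r.
have /not_andP[] := maxT S monS; first by case; left.
by move=> /contrapT /(_ (u, m)); apply; right.
Qed.

Lemma supports_monotone G a : 0 < a -> monotone_op (fun u => supports G (a *: u)).
Proof.
move=> a0 u x u' x' sx sx'; have [g Gx _] := sx; have [g' Gx' _] := sx'.
rewrite -(pmulr_rge0 _ a0).
have Hx : (G x <= g%:E)%E by rewrite Gx.
have Hx' : (G x' <= g'%:E)%E by rewrite Gx'.
have := supports_ineq sx Gx Hx'; have := supports_ineq sx' Gx' Hx.
rewrite !dotE; lra.
Qed.

(** A pair (u, v) monotonically related to the graph passes the radial test at
    a u with constant c = 0: this is monotonicity between u and u + (t / a) d. *)
Lemma supports_maximally_monotone G a : 0 < a -> coercive_lsc G ->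
  (forall w, segment_closed (supports G w)) ->
  maximally_monotone (fun u => supports G (a *: u)).
Proof.
move=> a0 cG cA; split; first exact: supports_monotone.
move=> S monS [sub nsub]; apply: nsub => -[u v] /= Suv.
apply: supports_radial => // d; exists 0 => t /andP[t0 t1].
have [z sz] := supports_exists (a *: u + t *: d) cG; exists z => //.
have wE : a *: u + t *: d = a *: (u + (t / a) *: d).
  by rewrite scalerDr scalerA mulrCA divff ?mulr1 // gt_eqF.
have Sz : S (u + (t / a) *: d) z by apply: (sub (_, _)); rewrite /svgraph /= -wE.
have := monS _ _ _ _ Sz Suv.
have -> : u + (t / a) *: d - u = (t / a) *: d by rewrite addrAC subrr add0r.
rewrite dotZl pmulr_rge0 ?divr_gt0 // dotDr dotNr (dotC d z) (dotC d v); lra.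
Qed.

End MaximalMonotonicity.

(** * Interiors of convex sets *)

Section ConvexSets.
Context {R : realType} {n : nat}.
Local Notation V := 'rV[R]_n.
Implicit Types (A C X : set V) (x y z v d : V) (r s t : R).

Lemma convex_setP A : @convex_set R V A <-> segment_closed A.
Proof.
split=> [cA x y t /andP[t0 t1] Ax Ay|cA].
  have := cA x y (Itv01 (ltW t0) (ltW t1)); rewrite !inE => /(_ Ax Ay).
  by [].
apply/convex_setW => x y; rewrite !inE => Ax Ay k k0 k1; rewrite inE.
by apply: (cA x y k%:num) => //; rewrite k0 k1.
Qed.

Lemma near_ball_ex x (P : V -> Prop) : (\forall z \near x, P z) ->
  exists2 r, 0 < r & forall z, `|x - z| < r -> P z.
Proof. by move=> /nbhs_normP [r /= r0 rP]; exists r => // z zr; exact: rP. Qed.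

Lemma ball_ex_near x (P : V -> Prop) r : 0 < r -> (forall z, `|x - z| < r -> P z) ->
  \forall z \near x, P z.
Proof. by move=> r0 rP; apply/nbhs_normP; exists r => // z; exact: rP. Qed.

Lemma near_ray x d (P : V -> Prop) : (\forall z \near x, P z) ->
  exists2 r, 0 < r < 1 & forall t, `|t| <= r -> P (x + t *: d).
Proof.
move=> /near_ball_ex [r r0 rP].
have D0 : 0 < r + `|d| + 1 by have := normr_ge0 d; lra.
exists (r / (r + `|d| + 1)).
  by rewrite divr_gt0 //= ltr_pdivrMr //; have := normr_ge0 d; lra.
move=> t; rewrite ler_pdivlMr // => tr; apply: rP.
rewrite opprD addrA subrr sub0r normrN normrZ.
have := normr_ge0 d; have := normr_ge0 t; nra.
Qed.

Lemma near_segment x z (P : V -> Prop) : (\forall y \near x, P y) ->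
  exists2 r, 0 < r < 1 & forall t, 0 < t <= r -> P (t *: z + (1 - t) *: x).
Proof.
move=> /(near_ray (z - x))[r r01 rP]; exists r => // t /andP[t0 tr].
have -> : t *: z + (1 - t) *: x = x + t *: (z - x).
  by apply/rowP => i; rewrite !mxE; ring.
by apply: rP; rewrite gtr0_norm.
Qed.

(** The ball of radius t r around t a + (1 - t) x is the image of the ball of
    radius r around a. *)
Lemma interior_segment X a x t : segment_closed X -> X° a -> X x -> 0 < t < 1 ->
  X° (t *: a + (1 - t) *: x).
Proof.
move=> cX /near_ball_ex[r r0 rX] Xx t01; have /andP[t0 t1] := t01.
apply: (@ball_ex_near _ _ (t * r)); first by rewrite mulr_gt0.
move=> z zr.
have -> : z = t *: (a + t^-1 *: (z - (t *: a + (1 - t) *: x))) + (1 - t) *: x.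
  rewrite scalerDr scalerA divff ?gt_eqF // scale1r.
  by apply/rowP => i; rewrite !mxE; ring.
apply: cX => //; apply: rX; rewrite opprD addrA subrr sub0r normrN normrZ.
by rewrite normfV gtr0_norm // mulrC ltr_pdivrMr // distrC mulrC.
Qed.

Lemma segment_closed_interior X : segment_closed X -> segment_closed X°.
Proof. by move=> cX x y t t01 Xx /interior_subset Xy; exact: interior_segment. Qed.

Lemma near_interior X x : X° x -> \forall y \near x, X° y.
Proof. by move=> Xx; apply: open_nbhs_nbhs; split=> //; exact: open_interior. Qed.

Lemma near_cvg_seq (x_ : nat -> V) x (P : V -> Prop) :
  x_ k @[k --> \oo] --> x -> (\forall z \near x, P z) ->
  exists N, forall k, P (x_ (k + N)%N).
Proof.
move=> cx nP; have /near_extract[N NP] : \forall k \near \oo, P (x_ k) by exact: cx.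
by exists N => k; rewrite addnC.
Qed.

End ConvexSets.

(** * Gradients, Frechet and limiting subgradients *)

Section Differentials.
Context {R : realType} {n : nat}.
Local Notation V := 'rV[R]_n.
Implicit Types (G h : V -> \bar R) (X : set V) (x y z u w v d : V) (a b c r t : R).

Lemma gradE G x d : differentiable (fine \o G) x ->
  'd (fine \o G) x d = dot (grad G x) d.
Proof.
move=> dG; rewrite {1}(row_sum_delta d) linear_sum /dot.
by apply: eq_bigr => i _; rewrite linearZ /= mxE deriveE // mulrC.
Qed.

Lemma grad_approx G x e : differentiable (fine \o G) x -> 0 < e ->
  \forall z \near x,
    `|fine (G z) - fine (G x) - dot (grad G x) (z - x)| <= e * `|z - x|.
Proof.
move=> dG e0; have := diff_locally dG; move/eqaddoP => /(_ e e0).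
move=> /near_ball_ex[r r0 H]; apply: (ball_ex_near r0) => z zr.
have := H (z - x); rewrite sub0r normrN distrC => /(_ zr).
by rewrite !fctE /= subrK gradE // opprD addrA.
Qed.

(** For a convex function, a first order lower bound near x propagates along
    segments to the whole space. *)
Lemma local_supports G x w g : epi_convex G -> G x = g%:E ->
  (forall e, 0 < e -> \forall z \near x, forall b, (G z <= b%:E)%E ->
     g + dot w (z - x) - e * `|z - x| <= b) -> supports G w x.
Proof.
move=> cG Gx H; exists g => // z b Gz.
suff E e : 0 < e -> g + dot w (z - x) - e * `|z - x| <= b.
  apply/ler_addgt0Pr => e e0; have D0 : 0 < `|z - x| + 1 by rewrite ltr_wpDl.
  have := E (e / (`|z - x| + 1)); rewrite divr_gt0 // => /(_ isT).
  have : e / (`|z - x| + 1) * `|z - x| <= e.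
    by rewrite mulrAC ler_pdivrMr // ler_pM2l // lerDl.
  lra.
move=> e0; have [r /andP[r0 r1]] := near_segment z (H e e0).
move=> /(_ r); rewrite r0 lexx => /(_ isT (r * b + (1 - r) * g)).
have -> : r *: z + (1 - r) *: x - x = r *: (z - x).
  by apply/rowP => i; rewrite !mxE; ring.
have Gr : (G (r *: z + (1 - r) *: x)%R <= (r * b + (1 - r) * g)%:E)%E.
  by apply: cG; rewrite ?r0 ?r1 // Gx.
move=> /(_ Gr); rewrite dotZr normrZ gtr0_norm // => Hr.
rewrite -(ler_pM2l r0); lra.
Qed.

(** The definition has the Euclidean norm in the quotient and the neighbourhoods
    come from the sup norm; the constants comparing the two norms are
    absorbed by e. *)
Lemma frechet_subdiffP X h x v : (forall z, X z -> (-oo < h z)%E) ->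
  frechet_subdiff X h x v <-> X x /\ exists2 g, h x = g%:E &
    forall e, 0 < e -> \forall z \near x, X z -> forall b, (h z <= b%:E)%E ->
      g + dot v (z - x) - e * `|z - x| <= b.
Proof.
move=> hny; split=> [[Xx hx lim0]|[Xx [g hx H]]].
- split=> //; exists (fine (h x)); first by rewrite fineK.
  move: (fine (h x)) (fineK hx) => g gE e e0; rewrite -gE in lim0.
  have e'0 : 0 < e / n.+1%:R by rewrite divr_gt0.
  have : ((- (e / n.+1%:R))%:E < limf_einf
    (fun z => (h z - g%:E - (dot v (z - x)%R)%:E) * ((enorm (z - x)%R)^-1)%:E)
    (within X x^'))%E by apply: lt_le_trans lim0; rewrite lte_fin oppr_lt0.
  rewrite limf_einfE => /ereal_sup_gt[_ [W FW <-] infW].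
  have : \forall z \near x, z != x -> X z -> W z by exact: FW.
  apply: filterS => z Wz Xz b hzb.
  have [zx|zx] := eqVneq z x.
    by rewrite zx subrr dot0r normr0 mulr0 addr0 subr0 -lee_fin gE -zx.
  have n0 : 0 < enorm (z - x).
    rewrite lt_neqAle enorm_ge0 andbT eq_sym; apply: contra zx => /eqP /enorm_eq0 /eqP.
    by rewrite subr_eq0.
  have := hny z Xz; case hz : (h z) hzb => [a| |] //; rewrite lee_fin => ab _.
  have : ((- (e / n.+1%:R))%:E <= (h z - g%:E - (dot v (z - x)%R)%:E) *
     ((enorm (z - x)%R)^-1)%:E)%E.
    apply: le_trans (ltW infW) _; apply: ereal_inf_lbound; exists z => //.
    exact: Wz.
  rewrite hz -!EFinB -EFinM lee_fin ler_pdivlMr // => H.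
  have : e / n.+1%:R * enorm (z - x) <= e * `|z - x|.
    rewrite -mulrA ler_pM2l // mulrC ler_pdivrMr // mulrC.
    exact: enorm_le_norm.
  by move: H; move: (e / _) => q; lra.
- split=> //; first by rewrite hx.
  apply/lee_addgt0Pr => e e0; rewrite limf_einfE -leeBlDr // add0e.
  apply: le_ereal_sup_tmp.
  exists (ereal_inf [set ((h z - h x - (dot v (z - x)%R)%:E) * ((enorm (z - x)%R)^-1)%:E)%E
     | z in [set z | [/\ z != x, X z & forall b, (h z <= b%:E)%E ->
      g + dot v (z - x) - e * `|z - x| <= b]]]).
    exists [set z | [/\ z != x, X z & forall b, (h z <= b%:E)%E ->
      g + dot v (z - x) - e * `|z - x| <= b]] => //.
    rewrite /within /=; apply: filterS (H e e0) => z Hz zx Xz; split=> //.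
    exact: Hz.
  apply/ereal_infP => _ [z [zx Xz Hz] <-].
  have n0 : 0 < enorm (z - x).
    rewrite lt_neqAle enorm_ge0 andbT eq_sym; apply: contra zx => /eqP /enorm_eq0 /eqP.
    by rewrite subr_eq0.
  rewrite hx; have := hny z Xz; case hz : (h z) Hz => [a| |] // Hz _; last first.
    by rewrite -addeA -EFinN -EFinD addye // gt0_mulye // ?lte_fin ?invr_gt0 // leey.
  rewrite -!EFinB -EFinM lee_fin ler_pdivlMr //.
  have := Hz a (lexx _); have := norm_le_enorm (z - x).
  have := ler_pM2l e0 (`|z - x|) (enorm (z - x)).
  by move=> E; rewrite -E; lra.
Qed.

Lemma frechet_limiting X h x v : frechet_subdiff X h x v -> limiting_subdiff X h x v.
Proof.
move=> fv; have [Xx hx _] := fv; split=> //; first by rewrite ltey_eq hx.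
by exists (fun=> x), (fun=> v); split=> //; exact: cvg_cst.
Qed.

Lemma supports_frechet G w x : (forall z, (-oo < G z)%E) -> supports G w x ->
  frechet_subdiff setT G x w.
Proof.
move=> Gny [g Gx H]; apply/frechet_subdiffP => //; split=> //; exists g => // e e0.
apply: (ball_ex_near ltr01) => z _ _ b Gz; have := H z b Gz; have := mulr_ge0 (ltW e0) (normr_ge0 (z - x)).
lra.
Qed.

End Differentials.

(** * Lower semicontinuity and coercivity *)

Section Semicontinuity.
Context {R : realType} {n : nat}.
Local Notation V := 'rV[R]_n.
Implicit Types (G f : V -> \bar R) (X : set V) (x y z u w v d : V) (a b c r t : R).

Lemma lsc_limit (g : \bar R) (h : nat -> \bar R) (a_ : nat -> R) a :
  (forall b, (b%:E < g)%E -> \forall k \near \oo, (b%:E < h k)%E) ->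
  a_ k @[k --> \oo] --> a -> (forall k, (h k <= (a_ k)%:E)%E) -> (g <= a%:E)%E.
Proof.
move=> hg ca ha; apply/lee_addgt0Pr => e e0; rewrite leNgt; apply/negP.
move=> /hg /near_extract[M MP].
have [N NP] := near_extract (cvg_norm_near ca e0).
have := MP N; rewrite addnC => H1; have := lt_le_trans H1 (ha _).
rewrite lte_fin; have := NP M; have := ler_norm (a_ (N + M)%N - a); rewrite distrC; lra.
Qed.

Lemma lsc_on_near X f (z_ : nat -> V) z b : lsc_on X f -> X z ->
  (forall k, X (z_ k)) -> z_ k @[k --> \oo] --> z -> (b%:E < f z)%E ->
  \forall k \near \oo, (b%:E < f (z_ k))%E.
Proof.
move=> lf Xz Xz_ cz /(lf z b)[W nW Wf].
have {nW} : \forall y \near z, X y -> W y.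
  by move: nW; rewrite /nbhs /= -nbhs_subspace_in.
move=> nW; have : \forall k \near \oo, X (z_ k) -> W (z_ k) by exact: cz nW.
by apply: filterS => k H; apply: Wf; apply: H; exact: Xz_.
Qed.

Lemma lsc_near G (z_ : nat -> V) z b : lower_semicontinuous G ->
  z_ k @[k --> \oo] --> z -> (b%:E < G z)%E ->
  \forall k \near \oo, (b%:E < G (z_ k))%E.
Proof.
move=> lG cz /lG[W nW WG].
have : \forall k \near \oo, W (z_ k) by exact: cz nW.
by apply: filterS => k; exact: WG.
Qed.

Lemma lsc_on_limit X f (z_ : nat -> V) z (a_ : nat -> R) a : lsc_on X f -> X z ->
  (forall k, X (z_ k)) -> z_ k @[k --> \oo] --> z -> a_ k @[k --> \oo] --> a ->
  (forall k, (f (z_ k) <= (a_ k)%:E)%E) -> (f z <= a%:E)%E.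
Proof.
move=> lf Xz Xz_ cz ca fa; apply: (lsc_limit _ ca fa) => b bf.
exact: (lsc_on_near lf Xz Xz_ cz bf).
Qed.

Lemma lower_semicontinuous_seq G : lower_semicontinuous G -> seq_lsc G.
Proof.
move=> lG z_ z a_ a cz ca Ga; apply: (lsc_limit _ ca Ga) => b bG.
exact: (lsc_near lG cz bG).
Qed.

(** Points with values tending to -oo would accumulate, and the value at the
    accumulation point would be -oo. *)
Lemma bounded_below G c : seq_lsc G -> (forall z, (-oo < G z)%E) ->
  exists m, forall z b, `|z| <= c -> (G z <= b%:E)%E -> m <= b.
Proof.
move=> lG Gny; apply: contrapT => /forallNP nm.
have /choice[z_ Hz] k : exists z, `|z| <= c /\ (G z <= (- k%:R)%:E)%E.
  have /existsNP[z /existsNP[b /not_implyP[zc /not_implyP[Gz /negP]]]] := nm (- k%:R).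
  by rewrite -ltNge => bk; exists z; split=> //; rewrite (le_trans Gz) // lee_fin ltW.
have [k|h [z [hk cz]]] := @bolzano_weierstrass R n z_ c; first by case: (Hz k).
have Gza a : (G z <= a%:E)%E.
  pose N := (Num.truncn `|a|).+1.
  apply: (lG (fun k => z_ (h (k + N)%N)) z (fun=> a) a).
  - by rewrite (@cvg_shiftn N _ (fun k => z_ (h k))).
  - exact: cvg_cst.
  move=> k; have [_ /le_trans] := Hz (h (k + N)%N); apply; rewrite lee_fin.
  have : N%:R <= (h (k + N)%N)%:R :> R.
    by rewrite ler_nat (leq_trans _ (hk _)) // leq_addl.
  have := truncnS_gt `|a|; have := ler_norm (- a); rewrite normrN /N; lra.
have := Gny z; case: (G z) Gza => [r| |] // H _.
  by have := H (r - 1); rewrite lee_fin; lra.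
by have := H 0; rewrite leye_eq.
Qed.

(** The liminf at infinity controls the function outside a ball; inside it,
    lower semicontinuity bounds it from below. *)
Lemma one_coercive_supercoercive G : seq_lsc G -> (forall z, (-oo < G z)%E) ->
  one_coercive G -> supercoercive G.
Proof.
move=> lG Gny coG K.
have : ((Num.max K 0)%:E < limf_einf (fun x => G x * ((enorm x)^-1)%:E) enorm_pinfty)%E.
  by rewrite coG ltry.
rewrite limf_einfE => /ereal_sup_gt[_ [W [M _ MW] <-] infW].
pose r := Num.max M 0; have [m Hm] := bounded_below r lG Gny.
exists (`|m| + `|K| * r) => z b Gz.
have r0 : 0 <= r by rewrite le_max lexx orbT.
have Mr : M <= r by rewrite le_max lexx.
have [zr|zr] := leP (enorm z) r.
  have := Hm z b (le_trans (norm_le_enorm z) zr) Gz; have := ler_norm (- m).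
  rewrite normrN => A B; have := ler_norm K; have := norm_le_enorm z.
  have := normr_ge0 z; have := normr_ge0 K; nra.
have n0 : 0 < enorm z by exact: le_lt_trans zr.
have Wz : W z by apply: MW; exact: le_lt_trans Mr zr.
have : ((Num.max K 0)%:E <= G z * ((enorm z)^-1)%:E)%E.
  by apply: le_trans (ltW infW) _; apply: ereal_inf_lbound; exists z.
have := Gny z; case: (G z) Gz => [g| |] //; rewrite lee_fin => gb _.
rewrite -EFinM lee_fin ler_pdivlMr // => H.
have : Num.max K 0 * `|z| <= Num.max K 0 * enorm z.
  by rewrite ler_wpM2l ?norm_le_enorm // le_max lexx orbT.
have : K * `|z| <= Num.max K 0 * `|z| by rewrite ler_wpM2r // le_max lexx.
have := normr_ge0 m; have := mulr_ge0 (normr_ge0 K) r0; lra.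
Qed.

Lemma convex_on_epi_convex G : convex_on setT G -> epi_convex G.
Proof.
move=> [_ cG] x y a b t t01 Gx Gy; apply: le_trans (cG _ _ _ _ _ t01) _ => //.
have /andP[t0 t1] := t01.
by rewrite [leRHS]EFinD !EFinM leeD // lee_wpmul2l // lee_fin ?subr_ge0 ltW.
Qed.

End Semicontinuity.

(** * The gradient of the conjugate *)

Section ConjugateDerivative.
Context {R : realType} {n : nat}.
Local Notation V := 'rV[R]_n.
Implicit Types (G f : V -> \bar R) (x y z u w v d : V) (a b c r t : R).

(** A closed graph and local boundedness give continuity wherever the map is
    single valued. *)
Lemma supports_continuous G w x : coercive_lsc G -> supports G w x ->
  (forall y, supports G w y -> y = x) ->
  forall e, 0 < e -> exists2 r, 0 < r &
    forall w' x', `|w' - w| < r -> supports G w' x' -> `|x' - x| < e.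
Proof.
move=> cG sx ux e e0; apply: contrapT => /forall2NP nr.
have /choice[p Hp] k : exists p : V * V, [/\ `|p.1 - w| < harmonic k,
    supports G p.1 p.2 & e <= `|p.2 - x|].
  have [] := nr (harmonic k); first by rewrite invr_gt0 ltr0n.
  move=> /existsNP[w' /existsNP[x' /not_implyP[ww' /not_implyP[sx' /negP]]]].
  by rewrite -leNgt => ex; exists (w', x').
have cw : (p k).1 @[k --> \oo] --> w.
  apply/cvgrPdist_lt => d d0; apply: filterS (cvg_norm_near (@cvg_harmonic R) d0) => k.
  rewrite sub0r normrN distrC => /(le_lt_trans (ler_norm _)); apply: lt_trans.
  by case: (Hp k).
have [M HM] := supports_bounded (`|w| + 1) cG.
have [k|h [z [hk cz]]] := @bolzano_weierstrass R n (fun k => (p k).2) M.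
  apply: HM; last by case: (Hp k) => _ s _; exact: s.
  have [lt_h _ _] := Hp k; have := ler_normD w ((p k).1 - w); rewrite addrC subrK.
  have : harmonic k <= 1 :> R by rewrite invf_le1 ?ler1n ?ltr0n.
  lra.
have sz : supports G w z.
  apply: (supports_closed (w_ := fun k => (p (h k)).1) cG _ cz) => [|k].
    exact: (cvg_comp _ _ (geq_id_cvgny hk) cw).
  by case: (Hp (h k)).
have [N HN] := near_extract (cvg_norm_near cz e0).
have := HN 0%N; rewrite (ux z sz) distrC ltNge.
by case: (Hp (h (N + 0)%N)) => _ _ ->.
Qed.

(** If z is supported by w + t e_i, the Fenchel-Young inequalities squeeze the
    difference quotient of the conjugate between x_i and z_i, and z tends to
    x. *)
Lemma grad_conjugate G w x : coercive_lsc G -> supports G w x ->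
  (forall y, supports G w y -> y = x) -> grad (conjugate G) w = x.
Proof.
move=> cG sx ux; apply/rowP => i; rewrite mxE /derive; apply: cvg_lim => //.
have [Gny _ _ _] := cG.
apply/cvgrPdist_lt => e e0.
have [r r0 rP] := supports_continuous cG sx ux e0.
have D0 : 0 < `|delta_mx 0 i : V| + 1 by rewrite ltr_wpDl.
rewrite near_withinE.
apply/nbhs_normP; exists (r / (`|delta_mx 0 i : V| + 1)) => /=; first by rewrite divr_gt0.
move=> t /=; rewrite sub0r normrN ltr_pdivlMr // => tr t0.
have [z sz] := supports_exists (t *: delta_mx 0 i + w) cG.
have zx : `|z - x| < e.
  apply: rP sz; rewrite addrK normrZ; apply: le_lt_trans tr.
  by rewrite ler_wpM2l // lerDl.
have zi := coord_le_norm (z - x) i; rewrite !mxE in zi.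
have [g Gx _] := sx; have [g' Gz _] := sz.
have := fconj_supports Gny sx Gx; have := fconj_supports Gny sz Gz; rewrite /fconj.
move=> c1 c2.
have Hx : (G x <= g%:E)%E by rewrite Gx.
have Hz : (G z <= g'%:E)%E by rewrite Gz.
have := supports_ineq sx Gx Hz; have := supports_ineq sz Gz Hx.
rewrite /= c1 c2 -[_^-1 *: _]/(_^-1 * _) !dotE ![dot (delta_mx _ _) _]dotC !dot_delta => A B.
apply: le_lt_trans zx; apply: le_trans zi.
move: (x 0 i) (z 0 i) (dot w z) (dot w x) A B => xi zi' wz wx A B.
have -> : xi - t^-1 * (t * zi' + wz - g' - (wx - g)) =
  t^-1 * (t * xi - (t * zi' + wz - g' - (wx - g))) by rewrite [RHS]mulrBr mulKf.
rewrite normrM normfV mulrC ler_pdivrMr ?normr_gt0 // -normrM.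
apply: (le_trans (y := (zi' - xi) * t)); last exact: ler_norm.
rewrite ler0_norm; lra.
Qed.

End ConjugateDerivative.

(** * Legendre distance-generating functions *)

Section LegendreFunctions.
Context {R : realType} {n : nat}.
Local Notation V := 'rV[R]_n.
Variable phi : V -> \bar R.
Hypotheses (dphi : dgf phi) (lphi : legendre phi) (cphi : one_coercive phi).
Local Notation X := (edom phi).
Local Notation Y := ((edom phi)°).
Implicit Types (x y z u w v d : V) (a b c r t : R).

Lemma dgf_gtNy z : (-oo < phi z)%E.
Proof. by have [[H _] _ _ _ _] := dphi; exact: H. Qed.

Lemma dgf_fineK x : X x -> phi x = (fine (phi x))%:E.
Proof. by rewrite /edom /=; have := dgf_gtNy x; case: (phi x). Qed.

Lemma dgf_edom x b : (phi x <= b%:E)%E -> X x.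
Proof. by move=> xb; rewrite /edom /= (le_lt_trans xb) ?ltry. Qed.

Lemma dgf_coercive_lsc : coercive_lsc phi.
Proof.
have [[_ [x0 _ Xx0]] lsc _ _ _] := dphi; have lphi' := lower_semicontinuous_seq lsc.
split=> //; [exact: dgf_gtNy| |].
- by exists x0, (fine (phi x0)); rewrite -dgf_fineK.
- by apply: one_coercive_supercoercive => //; exact: dgf_gtNy.
Qed.

Lemma dgf_epi_convex : epi_convex phi.
Proof. by have [_ _ cp _ _] := dphi; exact: convex_on_epi_convex. Qed.

Lemma dgf_edom_segment_closed : segment_closed X.
Proof.
move=> x y t t01 Xx Xy.
apply: (@dgf_edom _ (t * fine (phi x) + (1 - t) * fine (phi y))).
by apply: dgf_epi_convex => //; rewrite -dgf_fineK.
Qed.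

Lemma dgf_supports_ineq u y z : supports phi u y -> X z ->
  fine (phi y) + dot u (z - y) <= fine (phi z).
Proof. by move=> [g -> H] Xz; apply: H; rewrite -dgf_fineK. Qed.

Lemma supports_edom u y : supports phi u y -> X y.
Proof. by move=> [g py _]; apply: (@dgf_edom _ g); rewrite py. Qed.

Lemma grad_supports y : Y y -> supports phi (grad phi y) y.
Proof.
move=> Yy; have [_ _ _ _ dif] := dphi.
apply: (local_supports (g := fine (phi y))).
- exact: dgf_epi_convex.
- by rewrite -dgf_fineK //; exact: interior_subset.
move=> e e0; apply: filterS (grad_approx (dif y Yy) e0) => z H b zb.
have : fine (phi z) <= b by rewrite -lee_fin -dgf_fineK //; exact: dgf_edom zb.
by move: H; rewrite ler_norml => /andP[+ _]; lra.
Qed.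

(** If u is a subgradient, phi - <u, .> has a minimum at y, while its slope there
    is grad phi(y) - u; a step in the direction u - grad phi(y) would decrease
    it. *)
Lemma supports_grad u y : Y y -> supports phi u y -> u = grad phi y.
Proof.
move=> Yy su; have [_ _ _ _ dif] := dphi.
apply/eqP; rewrite -subr_eq0; apply/eqP/dot_eq0.
set d := u - grad phi y.
apply/ler_addgt0Pr => e e0; rewrite add0r.
have D0 : 0 < `|d| + 1 by rewrite ltr_wpDl.
have e'0 : 0 < e / (`|d| + 1) by rewrite divr_gt0.
have nr : \forall z \near y, X z /\
  `|fine (phi z) - fine (phi y) - dot (grad phi y) (z - y)| <= e / (`|d| + 1) * `|z - y|.
  by apply: filterS2 Yy (grad_approx (dif y Yy) e'0) => z.
have [r /andP[r0 r1] rP] := near_ray d nr.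
have [] := rP r; first by rewrite gtr0_norm.
move=> Xz; rewrite ler_norml addrAC subrr add0r => /andP[_].
have := dgf_supports_ineq su Xz.
rewrite addrAC subrr add0r normrZ gtr0_norm // !dotZr => A B.
have dd : dot d d = dot u d - dot (grad phi y) d by rewrite -dotNl -dotDl.
have : e / (`|d| + 1) * (r * `|d|) <= r * e.
  rewrite mulrCA ler_pM2l // mulrAC ler_pdivrMr // ler_pM2l // lerDl.
  exact: ler01.
move=> C; rewrite dd -(ler_pM2l r0); lra.
Qed.

(** A subgradient at y evaluated at the points y0 + e e_i and y0 - e e_i, where
    phi is finite, bounds its i-th coordinate. The term dot u (y - y0) is kept:
    it is small when y is near y0, and monotonicity controls it when y runs
    along a segment issued from y0. *)
Lemma supports_bound_near y0 : Y y0 -> exists2 e, 0 < e & exists c, forall u y,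
  supports phi u y -> e * `|u| <= c - fine (phi y) + dot u (y - y0).
Proof.
move=> /near_ball_ex[r r0 rX].
(* Dividing the radius by D makes the step e valid for all basis vectors. *)
pose D := \sum_i `|delta_mx 0 i : V| + 1.
have D0 : 0 < D by rewrite ltr_wpDl // sumr_ge0.
pose e := r / D; have e0 : 0 < e by rewrite divr_gt0.
have Xe t i : `|t| <= e -> X (y0 + t *: delta_mx 0 i).
  move=> te; apply: rX; rewrite opprD addrA subrr sub0r normrN normrZ.
  apply: (@le_lt_trans _ _ (e * `|delta_mx 0 i : V|)); first by rewrite ler_wpM2r.
  rewrite mulrAC ltr_pdivrMr // ltr_pM2l // /D (bigD1 i) //=.
  rewrite -addrA ltrDl ltr_wpDl // sumr_ge0 //.
pose M i := `|fine (phi (y0 + e *: delta_mx 0 i))| + `|fine (phi (y0 + (- e) *: delta_mx 0 i))|.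
pose c := \sum_i M i.
have Mc i : M i <= c.
  by rewrite /c (bigD1 i) //= lerDl sumr_ge0 // => j _; rewrite addr_ge0.
exists e => //; exists (c + `|fine (phi y0)|) => u y su.
have Hi t i : `|t| = e -> t * u 0 i <= c - fine (phi y) + dot u (y - y0).
  move=> te; have := Xe t i; rewrite te lexx => /(_ isT) Xt.
  have := dgf_supports_ineq su Xt.
  have : fine (phi (y0 + t *: delta_mx 0 i)) <= c.
    apply: le_trans (Mc i); rewrite /M.
    have := normr_ge0 (fine (phi (y0 + e *: delta_mx 0 i))).
    have := normr_ge0 (fine (phi (y0 + (- e) *: delta_mx 0 i))).
    have := ler_norm (fine (phi (y0 + t *: delta_mx 0 i))).
    have [->|->] : t = e \/ t = - e; [|lra|lra].
    by rewrite -te; case: (ger0P t) => _; [left|right; rewrite opprK].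
  rewrite !dotE dot_delta; lra.
have pos : 0 <= c + `|fine (phi y0)| - fine (phi y) + dot u (y - y0).
  have Xa : X y0 by apply: rX; rewrite subrr normr0.
  have := dgf_supports_ineq su Xa.
  have := ler_norm (fine (phi y0)); have : 0 <= c by rewrite sumr_ge0 // => i _; rewrite addr_ge0.
  rewrite !dotE; lra.
rewrite mulrC -ler_pdivlMr //; apply: norm_le_coord; first by rewrite divr_ge0 // ltW.
move=> i; rewrite ler_pdivlMr // mulrC -[e]gtr0_norm // -normrM.
rewrite ler_norml; apply/andP; split; last first.
  by have := Hi e i (gtr0_norm e0); have := normr_ge0 (fine (phi y0)); lra.
by have := Hi (- e) i; rewrite normrN gtr0_norm // => /(_ erefl); have := normr_ge0 (fine (phi y0)); lra.
Qed.

(** On the segment from a boundary point x to a point a of Y, monotonicity bounds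
    <grad phi, a - x> from below. If phi had a subgradient at x, the previous
    lemma would then bound the gradients along the segment, against essential
    smoothness. *)
Lemma supports_interior u x : supports phi u x -> Y x.
Proof.
move=> su; have [[[a Ya] _ ess] _] := lphi; apply: contrapT => nYx.
have Xx := supports_edom su.
pose s k : R := k.+2%:R^-1.
have s01 k : 0 < s k < 1 by rewrite /s invr_gt0 ltr0n invf_lt1 ?ltr1n.
pose x_ k := s k *: a + (1 - s k) *: x.
have Yx k : Y (x_ k) by apply: interior_segment => //; exact: dgf_edom_segment_closed.
have cx : x_ k @[k --> \oo] --> x.
  rewrite [X in _ --> X](_ : x = 0 *: a + (1 - 0) *: x); last first.
    by rewrite scale0r add0r subr0 scale1r.
  apply: cvgD; apply: cvgZr_tmp; first exact: cvg_harmonicS.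
  by apply: cvgB; [exact: cvg_cst|exact: cvg_harmonicS].
have bx : boundary X x.
  split; last exact: nYx.
  exact: subset_closure.
have [e e0 [c Hc]] := supports_bound_near Ya.
have /cvgeyPgt /(_ (n.+1%:R * ((c - fine (phi x) - dot u (a - x)) / e))) := ess x_ x Yx bx cx.
move=> /near_extract[N /(_ 0%N)]; rewrite addn0 lte_fin ltNge => /negP; apply.
apply: le_trans (enorm_le_norm _) _; rewrite ler_pM2l // ler_pdivlMr // mulrC.
have sk := grad_supports (Yx N).
apply: le_trans (Hc _ _ sk) _.
have Xk : X (x_ N) by exact: interior_subset.
have := dgf_supports_ineq su Xk; have := dgf_supports_ineq sk Xx.
have -> : x_ N - x = s N *: (a - x) by apply/rowP => i; rewrite !mxE; ring.
have -> : x - x_ N = - (s N *: (a - x)) by apply/rowP => i; rewrite !mxE; ring.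
have -> : x_ N - a = - ((1 - s N) *: (a - x)) by apply/rowP => i; rewrite !mxE; ring.
move: (grad phi (x_ N)) (fine (phi (x_ N))) (fine (phi x)) (a - x) => g p q d.
rewrite !dotE; have /andP[t0 t1] := s01 N; move: (s N) t0 t1 => t t0 t1 A B.
have : dot u d <= dot g d by rewrite -(ler_pM2l t0); lra.
nra.
Qed.

(** Both points lie in Y, a convex subset of the domain of the subdifferential,
    where phi is strictly convex. *)
Lemma supports_unique u x y : supports phi u x -> supports phi u y -> x = y.
Proof.
move=> sx sy; apply: contrapT => xy; have [_ strict] := lphi.
have Yx := supports_interior sx; have Yy := supports_interior sy.
have half : 0 < (2^-1 : R) < 1 by rewrite invr_gt0 ltr0n invf_lt1 ?ltr1n.
have cY : @convex_set R V Y.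
  by apply/convex_setP/segment_closed_interior; exact: dgf_edom_segment_closed.
have Ysub : Y `<=` svdom (limiting_subdiff setT phi).
  move=> z Yz; exists (grad phi z); apply/frechet_limiting/supports_frechet.
    exact: dgf_gtNy.
  exact: grad_supports.
have := strict Y cY Ysub x y 2^-1 Yx Yy xy half.
have Xm : X (2^-1 *: x + (1 - 2^-1) *: y).
  by apply: dgf_edom_segment_closed => //; exact: interior_subset.
have Xx := supports_edom sx; have Xy := supports_edom sy.
have := dgf_supports_ineq sx Xm; have := dgf_supports_ineq sy Xm.
rewrite (dgf_fineK Xm) (dgf_fineK Xx) (dgf_fineK Xy) -!EFinM -EFinD lte_fin !dotE.
lra.
Qed.

Lemma nabla_conjugate u : nabla (conjugate phi) u = [set y | supports phi u y].
Proof.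
apply/seteqP; split=> y /=.
  move=> [_ ->]; have [z sz] := supports_exists u dgf_coercive_lsc.
  rewrite (grad_conjugate dgf_coercive_lsc sz) // => y' sy'.
  exact: supports_unique sy' sz.
move=> sy; split; last first.
  by rewrite (grad_conjugate dgf_coercive_lsc sy) // => y' /supports_unique; apply.
have -> : edom (conjugate phi) = setT.
  apply/seteqP; split=> // w _; rewrite /edom /= conjugateE ?ltry //.
  exact: dgf_coercive_lsc.
by rewrite interiorT.
Qed.

(** Continuity along a subsequence suffices for passing to the limit, and only
    needs the closed graph and local boundedness of the gradient. *)
Lemma grad_continuous (y_ : nat -> V) y : Y y -> (forall k, Y (y_ k)) ->
  y_ k @[k --> \oo] --> y ->
  exists2 h : nat -> nat, (forall k, k <= h k)%N &
    grad phi (y_ (h k)) @[k --> \oo] --> grad phi y.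
Proof.
move=> Yy Yk cy; have [e e0 [c Hc]] := supports_bound_near Yy.
have sk k := grad_supports (Yk k).
have nr : \forall z \near y, n%:R * `|z - y| <= e / 2.
  have D0 : 0 < n%:R + 1 :> R by rewrite ltr_wpDl.
  have r0 : 0 < e / 2 / (n%:R + 1) by rewrite !divr_gt0.
  apply: (ball_ex_near r0) => z; rewrite distrC ltr_pdivlMr // => /ltW.
  by apply: le_trans; rewrite mulrC ler_wpM2l // lerDl.
have [N HN] := near_cvg_seq cy nr.
pose B := (c - fine (phi y) + `|grad phi y| * (e / 2)) / (e / 2).
have [k|h [u [hk cu]]] := @bolzano_weierstrass R n (fun k => grad phi (y_ (k + N)%N)) B.
  rewrite ler_pdivlMr ?divr_gt0 //.
  have Xk : X (y_ (k + N)%N) by exact: interior_subset.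
  have := dgf_supports_ineq (grad_supports Yy) Xk; have := Hc _ _ (sk (k + N)%N).
  have := HN k; move: (y_ (k + N)%N) (grad phi (y_ _)) => z g zn.
  have := normr_dot_le g (z - y); have := normr_dot_le (grad phi y) (z - y).
  have := ler_norm (- dot (grad phi y) (z - y)); have := ler_norm (dot g (z - y)).
  rewrite normrN !(mulrCA n%:R).
  have := ler_wpM2l (normr_ge0 g) zn; have := ler_wpM2l (normr_ge0 (grad phi y)) zn.
  lra.
have le_h k : (k <= h k + N)%N by rewrite (leq_trans (hk k)) // leq_addr.
exists (fun k => h k + N)%N => //.
suff -> : grad phi y = u by [].
apply/esym/supports_grad => //.
apply: (supports_closed dgf_coercive_lsc cu) (fun k => sk (h k + N)%N).
exact: (cvg_comp _ _ (geq_id_cvgny le_h) cy).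
Qed.

End LegendreFunctions.

(** * Relative interiors *)

Section RelativeInterior.
Context {R : realType} {n : nat}.
Local Notation V := 'rV[R]_n.
Implicit Types (G : V -> \bar R) (C S : set V) (x y z v d : V) (a b c r t : R).

Lemma sub_convex_hull C : C `<=` convex_hull C.
Proof. exact: sub_gen_smallest. Qed.

Lemma convex_hull_segment_closed C : segment_closed (convex_hull C).
Proof.
move=> x y t t01 Cx Cy A AC; have [/convex_setP sA _] := AC.
exact: sA t01 (Cx A AC) (Cy A AC).
Qed.

Lemma convex_hull_sub C D : C `<=` D -> segment_closed D -> convex_hull C `<=` D.
Proof. by move=> CD /convex_setP cD; exact: smallest_sub. Qed.

Lemma convex_hull_id C : segment_closed C -> convex_hull C = C.
Proof.
move=> cC; apply/seteqP; split; last exact: sub_convex_hull.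
exact: convex_hull_sub.
Qed.

Lemma aff_affine C : affine_set (aff C).
Proof.
move=> x y t Ax Ay A AC; have [aA _] := AC.
exact: aA (Ax A AC) (Ay A AC).
Qed.

Lemma sub_aff C : C `<=` aff C.
Proof. exact: sub_gen_smallest. Qed.

(** Jensen's inequality with the remaining weight at x; the sum of the weights is
    strictly below 1 so that the induction can divide by 1 - a i. *)
Lemma jensen_at G x g (I : Type) (s : seq I) (e : I -> V) (M a : I -> R) :
  epi_convex G -> (G x <= g%:E)%E ->
  (forall i, (G (x + e i)%R <= (g + M i)%:E)%E) ->
  (forall i, 0 <= a i) -> \sum_(i <- s) a i < 1 ->
  (G (x + \sum_(i <- s) a i *: e i)%R <= (g + \sum_(i <- s) a i * M i)%:E)%E.
Proof.
move=> cG Gx Ge; elim: s a => [|i s IH] a a0; first by move=> _; rewrite !big_nil !addr0.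
rewrite !big_cons => sa1.
have s0 (b : I -> R) : (forall j, 0 <= b j) -> 0 <= \sum_(j <- s) b j.
  by move=> b0; apply: sumr_ge0 => j _.
have ai1 : a i < 1 by have := s0 a a0; lra.
have [ai0|ai0] := eqVneq (a i) 0.
  by rewrite ai0 scale0r mul0r !add0r; apply: IH => //; move: sa1; rewrite ai0 add0r.
have {}ai0 : 0 < a i by rewrite lt_neqAle eq_sym ai0 a0.
have d0 : 0 < 1 - a i by rewrite subr_gt0.
pose b j := a j / (1 - a i).
have sb : \sum_(j <- s) b j = (\sum_(j <- s) a j) / (1 - a i) by rewrite mulr_suml.
have sb1 : \sum_(j <- s) b j < 1 by rewrite sb ltr_pdivrMr // mul1r; lra.
have := IH b (fun j => divr_ge0 (a0 j) (ltW d0)) sb1 => Gb.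
have -> : x + (a i *: e i + \sum_(j <- s) a j *: e j) =
    a i *: (x + e i) + (1 - a i) *: (x + \sum_(j <- s) b j *: e j).
  have -> : \sum_(j <- s) a j *: e j = (1 - a i) *: \sum_(j <- s) b j *: e j.
    rewrite scaler_sumr; apply: eq_bigr => j _.
    by rewrite scalerA /b mulrC divfK // gt_eqF.
  by move: (\sum_(j <- s) _) => w; apply/rowP => k; rewrite !mxE; ring.
have -> : g + (a i * M i + \sum_(j <- s) a j * M j) =
    a i * (g + M i) + (1 - a i) * (g + \sum_(j <- s) b j * M j).
  have -> : \sum_(j <- s) a j * M j = (1 - a i) * \sum_(j <- s) b j * M j.
    rewrite mulr_sumr; apply: eq_bigr => j _.
    by rewrite /b mulrA [(1 - _) * _]mulrC divfK // gt_eqF.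
  ring.
by apply: cG => //; rewrite ai0.
Qed.

(** Jensen's inequality for the indicator function of C. *)
Lemma segment_closed_jensen C x (I : Type) (s : seq I) (e : I -> V) (a : I -> R) :
  segment_closed C -> C x -> (forall i, C (x + e i)) ->
  (forall i, 0 <= a i) -> \sum_(i <- s) a i < 1 -> C (x + \sum_(i <- s) a i *: e i).
Proof.
move=> cC Cx Ce a0 sa1; pose G z : \bar R := if z \in C then 0%E else +oo%E.
have GE z b : (G z <= b%:E)%E <-> C z /\ 0 <= b.
  rewrite /G; case: ifPn => [|/negP]; rewrite inE => Cz.
    by rewrite lee_fin; split=> [//|[]].
  by rewrite leye_eq; split=> // -[].
have cG : epi_convex G.
  move=> y z b c t t01 /GE[Cy b0] /GE[Cz c0]; apply/GE; split; first exact: cC.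
  by case/andP: t01 => t0 t1; rewrite addr_ge0 // mulr_ge0 //; lra.
have := @jensen_at G x 0 I s e (fun=> 0) a cG.
by case/(_ _ _ a0 sa1)/GE => // [|i]; apply/GE; split=> //; rewrite addr0.
Qed.

(** A free family of S of maximal size spans S. *)
Lemma spanning_rows S : exists m (B : 'M[R]_(m, n)),
  [/\ row_free B, forall i, S (row i B) & forall v, S v -> (v <= B)%MS].
Proof.
pose P m := `[< exists B : 'M[R]_(m, n), row_free B /\ forall i, S (row i B) >].
have P0 : exists m, P m.
  exists 0%N; apply/asboolP; exists 0; split; last by case.
  by rewrite /row_free mxrank0.
have Pn m : P m -> (m <= n)%N.
  by move=> /asboolP[B [/eqP fB _]]; have := rank_leq_col B; rewrite fB.
case: (ex_maxnP P0 Pn) => m /asboolP[B [fB SB]] maxm.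
exists m, B; split=> // v Sv; apply: contrapT => /negP vB.
have : P (m + 1)%N.
  apply/asboolP; exists (col_mx B v); split; last first.
    move=> i; case: (split_ordP i) => j ->; first by rewrite rowKu.
    by rewrite rowKd ord1 row_id.
  have ltB : (B < B + v)%MS.
    rewrite ltmxE addsmxSl /=; apply/negP => /(submx_trans (addsmxSr B v)).
    exact/negP.
  have := rank_ltmx ltB; rewrite /row_free eqn_leq rank_leq_row /= addsmxE.
  by move/eqP: fB => {1}->; rewrite -{1}addn1.
by move=> /maxm; rewrite addn1 ltnn.
Qed.

Lemma aff_sub_rows C x m (B : 'M[R]_(m, n)) : C x ->
  (forall v, C (x + v) -> (v <= B)%MS) -> forall z, aff C z -> (z - x <= B)%MS.
Proof.
move=> Cx CB z Az; apply: (smallest_sub (X := [set z | (z - x <= B)%MS])) Az.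
  move=> u v t /= uB vB.
  have -> : t *: u + (1 - t) *: v - x = t *: (u - x) + (1 - t) *: (v - x).
    by apply/rowP => i; rewrite !mxE; ring.
  by rewrite addmx_sub // scalemx_sub.
by move=> y Cy /=; apply: CB; rewrite addrC subrK.
Qed.

Lemma row_coordinates m (B : 'M[R]_(m, n)) : exists2 K, 0 <= K &
  forall v, (v <= B)%MS -> v = \sum_i (v *m pinvmx B) 0 i *: row i B /\
    forall i, `|(v *m pinvmx B) 0 i| <= K * `|v|.
Proof.
exists (\sum_j \sum_i `|pinvmx B j i|).
  by apply: sumr_ge0 => j _; apply: sumr_ge0.
move=> v vB; split; first by rewrite -{1}(mulmxKpV vB) mulmx_sum_row.
move=> i; rewrite mxE; apply: le_trans (ler_norm_sum _ _ _) _.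
rewrite mulr_suml; apply: ler_sum => j _; rewrite normrM mulrC ler_pM ?coord_le_norm //.
by rewrite (bigD1 i) //= lerDl sumr_ge0.
Qed.

Lemma aff_line C x v t : C x -> C (x + v) -> aff C (x + t *: v).
Proof.
move=> Cx Cv; have -> : x + t *: v = t *: (x + v) + (1 - t) *: x.
  by apply/rowP => i; rewrite !mxE; ring.
by apply: aff_affine; exact: sub_aff.
Qed.

(** With a basis of the direction space taken from C - x, a point z of the affine
    hull near x is x plus a combination of the vectors + e_i b_i and - e_i b_i
    with weights at most proportional to |z - x|, and Jensen's inequality
    applies. *)
Lemma relint_calm C G x g : relint C x -> epi_convex G -> (G x <= g%:E)%E ->
  (forall z, C z -> exists b, (G z <= b%:E)%E) ->
  exists2 r, 0 < r & exists L, forall z, aff C z -> `|x - z| < r ->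
    (G z <= (g + L * `|z - x|)%:E)%E.
Proof.
move=> [Cx nearC] cG Gx finG.
have [m [B [fB SB BS]]] := spanning_rows [set v | C (x + v)].
have [K K0 HK] := row_coordinates B.
have /choice[e He] i : exists e, 0 < e /\ forall t, `|t| <= e -> C (x + t *: row i B).
  have [e /andP[e0 _] He] := near_ray (row i B) nearC.
  by exists e; split=> // t te; apply: He => //; apply: aff_line => //; exact: SB.
have /choice[M HM] i : exists M, forall t, `|t| = e i ->
    (G (x + t *: row i B)%R <= (g + M)%:E)%E.
  have [e0 Ce] := He i.
  have [|b1 H1] := finG _ (Ce (e i) _); first by rewrite gtr0_norm.
  have [|b2 H2] := finG _ (Ce (- e i) _); first by rewrite normrN gtr0_norm.
  exists (`|b1 - g| + `|b2 - g|) => t te.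
  have [->|->] : t = e i \/ t = - e i.
    by rewrite -te; case: (ger0P t) => _; [left|right; rewrite opprK].
  - apply: le_trans H1 _; rewrite lee_fin.
    by have := ler_norm (b1 - g); have := normr_ge0 (b2 - g); lra.
  - apply: le_trans H2 _; rewrite lee_fin.
    by have := ler_norm (b2 - g); have := normr_ge0 (b1 - g); lra.
pose D := \sum_i K / e i.
have Ke i : 0 <= K / e i by rewrite divr_ge0 // ltW //; case: (He i).
have D0 : 0 < D + 1 by rewrite ltr_wpDl // sumr_ge0.
exists (D + 1)^-1; first by rewrite invr_gt0.
exists (\sum_i K / e i * `|M i|) => z Az.
rewrite distrC -[ltRHS]mul1r ltr_pdivlMr // => zr.
have zB := aff_sub_rows Cx BS Az.
have [zE cK] := HK _ zB; set c := _ *m _ in zE cK.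
pose a i := `|c 0 i| / e i.
(* The sign of the coordinate goes into the vector, so that weights are
   nonnegative. *)
pose v i := (if 0 <= c 0 i then e i else - e i) *: row i B.
have e0 i : 0 < e i by case: (He i).
have aK i : a i <= K / e i * `|z - x|.
  by rewrite /a mulrAC ler_pM2r ?invr_gt0 // cK.
have a0 i : 0 <= a i by rewrite divr_ge0 // ltW.
have sa : \sum_i a i < 1.
  apply: (@le_lt_trans _ _ (D * `|z - x|)).
    by rewrite /D mulr_suml; apply: ler_sum => i _.
  by move: zr; have := normr_ge0 (z - x); lra.
have zx : z = x + \sum_i a i *: v i.
  rewrite -[LHS](subrK x) addrC {1}zE; congr (_ + _); apply: eq_bigr => i _.
  rewrite /v scalerA; congr (_ *: _); rewrite /a.
  have ei : e i != 0 by rewrite gt_eqF.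
  by case: ger0P => _; rewrite ?mulrN divfK // opprK.
have := @jensen_at G x g 'I_m (index_enum _) v M a cG Gx _ a0 sa.
rewrite -zx => /(_ _) H; apply: le_trans (H _) _ => [i|].
  apply: HM; case: ifP => _; rewrite ?normrN gtr0_norm //.
rewrite lee_fin lerD2l mulr_suml; apply: ler_sum => i _.
rewrite [leRHS]mulrAC; apply: le_trans (ler_norm _) _; rewrite normrM (ger0_norm (a0 i)).
by rewrite ler_wpM2r.
Qed.

(** The barycentre of x and of x + b_i, for a maximal free family b of C - x: a
    small change in the affine hull keeps its barycentric coordinates
    nonnegative. *)
Lemma relint_nonempty C : segment_closed C -> C !=set0 -> relint C !=set0.
Proof.
move=> cC [x Cx].
have [m [B [fB SB BS]]] := spanning_rows [set v | C (x + v)].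
have [K K0 HK] := row_coordinates B.
(* The barycentric weight of each of the m + 1 points. *)
pose q : R := m.+1%:R^-1.
have q0 : 0 < q by rewrite invr_gt0.
pose y := x + \sum_(i < m) q *: row i B.
have yB : (y - x <= B)%MS.
  rewrite /y addrC addKr; apply: summx_sub => i _.
  by rewrite scalemx_sub // row_sub.
have yc i : ((y - x) *m pinvmx B) 0 i = q.
  rewrite /y addrC addKr.
  have -> : \sum_(i < m) q *: row i B = const_mx q *m B.
    by rewrite mulmx_sum_row; apply: eq_bigr => j _; rewrite mxE.
  by rewrite mulmxKp // mxE.
have sumq : \sum_(i < m) q = m%:R * q by rewrite sumr_const card_ord mulr_natl.
have mq : m%:R * q = 1 - q.
  have : m.+1%:R * q = 1 by rewrite divff.
  by rewrite -natr1 mulrDl mul1r; lra.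
have inC (a : 'I_m -> R) : (forall i, 0 <= a i) -> \sum_i a i < 1 ->
    C (x + \sum_i a i *: row i B).
  by apply: segment_closed_jensen => // i; exact: SB.
exists y; split.
  by apply: inC => [i|]; [exact: ltW|rewrite sumq mq; lra].
(* Changes of the coordinates below q * q keep them nonnegative and their
   sum at most (1 - q) (1 + q) = 1 - q * q < 1. *)
have r0 : 0 < q * q / (K + 1) by rewrite divr_gt0 ?mulr_gt0 // ltr_wpDl.
apply: (ball_ex_near r0) => z; rewrite ltr_pdivlMr ?ltr_wpDl // distrC => zr Az.
have zB := aff_sub_rows Cx BS Az.
have [zE _] := HK _ zB; set c := _ *m _ in zE.
have cq i : `|c 0 i - q| <= q * q.
  have -> : c 0 i - q = ((z - y) *m pinvmx B) 0 i.
    have -> : z - y = (z - x) - (y - x) by apply/rowP => j; rewrite !mxE; ring.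
    by rewrite mulmxBl [RHS]mxE [X in _ = _ + X]mxE yc.
  have [|_ cK] := HK (z - y).
    have -> : z - y = (z - x) - (y - x) by apply/rowP => j; rewrite !mxE; ring.
    by rewrite addmx_sub // eqmx_opp.
  by apply: le_trans (cK i) _; have := normr_ge0 (z - y); lra.
have q1 : q <= 1 by rewrite invf_le1 ?ler1n ?ltr0n.
rewrite -[z](subrK x) addrC zE; apply: inC => [i|].
  by have := cq i; rewrite ler_norml => /andP[+ _]; nra.
apply: (@le_lt_trans _ _ (\sum_(i < m) (q + q * q))).
  by apply: ler_sum => i _; have := cq i; rewrite ler_norml => /andP[_]; lra.
by rewrite big_split /= -mulr_sumr sumq mq; nra.
Qed.

Lemma relint_segment C x y t : segment_closed C -> relint C x -> C y -> 0 < t < 1 ->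
  relint C (t *: x + (1 - t) *: y).
Proof.
move=> cC [Cx /near_ball_ex[r r0 rC]] Cy t01; have /andP[t0 t1] := t01.
split; first exact: cC.
apply: (@ball_ex_near _ _ _ _ (t * r)); first by rewrite mulr_gt0.
move=> z zr Az.
have zE : z = t *: (x + t^-1 *: (z - (t *: x + (1 - t) *: y))) + (1 - t) *: y.
  rewrite scalerDr scalerA divff ?gt_eqF // scale1r.
  by apply/rowP => i; rewrite !mxE; ring.
rewrite zE; apply: cC => //; apply: rC.
  rewrite opprD addrA subrr sub0r normrN normrZ.
  by rewrite normfV gtr0_norm // mulrC ltr_pdivrMr // distrC mulrC.
have -> : x + t^-1 *: (z - (t *: x + (1 - t) *: y)) = t^-1 *: z + (1 - t^-1) *: y.
  apply/rowP => i; rewrite !mxE; field; exact: lt0r_neq0.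
by apply: aff_affine => //; exact: sub_aff.
Qed.

End RelativeInterior.

(** * Proximal maps, envelopes and hulls in terms of the shifted function *)

Section BregmanProximity.
Context {R : realType} {n : nat}.
Local Notation V := 'rV[R]_n.
Variables (phi f : V -> \bar R) (lambda : R).
Local Notation X := (edom phi).
Local Notation Y := ((edom phi)°).
Hypotheses (dphi : dgf phi) (lphi : legendre phi) (cphi : one_coercive phi).
Hypotheses (pf : proper_on X f) (lf : lsc_on X f) (lambda0 : 0 < lambda).
Hypothesis (thr : (lambda%:E < prox_threshold phi f)%E).
Local Notation mu := (lambda^-1).
Implicit Types (x y z u w v d : V) (a b c r t : R).

Let mu0 : 0 < mu. Proof. by rewrite invr_gt0. Qed.

Lemma proper_gtNy x : X x -> (-oo < f x)%E.
Proof. by have [H _] := pf; exact: H. Qed.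

(** The extension by +oo lets subgradient inequalities range over the whole
    space; taking the real value of phi keeps the sum free of opposite
    infinities. *)
Definition shifted x : \bar R :=
  if x \in (X : set V) then (f x + (mu * fine (phi x))%:E)%E else +oo%E.
Local Notation F := shifted.

Lemma shifted_leP x b :
  (F x <= b%:E)%E <-> X x /\ (f x <= (b - mu * fine (phi x))%:E)%E.
Proof.
rewrite /shifted; case: ifPn => [|/negP]; rewrite inE => Xx.
  by rewrite EFinB leeBrDr //; split=> [//|[]].
by rewrite leye_eq; split=> // -[].
Qed.

Lemma shiftedE x : X x -> F x = (f x + mu%:E * phi x)%E.
Proof. by move=> Xx; rewrite /shifted mem_set // EFinM -dgf_fineK. Qed.

Lemma shifted_gtNy z : (-oo < F z)%E.
Proof.
rewrite /shifted; case: ifPn => //; rewrite inE => /proper_gtNy.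
by case: (f z) => // r _; rewrite -EFinD ltNyr.
Qed.

Lemma bregmanE x y : X x -> Y y -> bregman phi x y =
  (fine (phi x) - fine (phi y) - dot (grad phi y) (x - y))%:E.
Proof.
move=> Xx Yy; rewrite /bregman mem_set // (dgf_fineK dphi Xx).
by rewrite (dgf_fineK dphi (interior_subset Yy)).
Qed.

(** At a parameter l above lambda for which the envelope is finite,
    f >= c - (1/l) D(., y); adding mu phi leaves the coefficient
    k = mu - 1/l > 0 in front of phi. *)
Lemma shifted_minorant : exists (g : V) (c k : R), 0 < k /\
  forall x b, (F x <= b%:E)%E -> k * fine (phi x) + dot g x + c <= b.
Proof.
have [_ [l [l0 [y Yy env]] <-]] := ereal_sup_gt thr.
rewrite lte_fin => ll.
have [c cle] : exists c, (c%:E <= left_env phi l f y)%E.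
  move: env; case: (left_env _ _ _ _) => [r| |] // _; first by exists r.
  by exists 0; rewrite leey.
exists (l^-1 *: grad phi y), (c + l^-1 * (fine (phi y) - dot (grad phi y) y)), (mu - l^-1).
split; first by rewrite subr_gt0 ltf_pV2.
move=> x b /shifted_leP[Xx fx].
have : (c%:E <= f x + l^-1%:E * bregman phi x y)%E.
  by apply: le_trans cle _; apply: ereal_inf_lbound; exists x.
rewrite bregmanE // -EFinM => cf.
have : (c%:E <= (b - mu * fine (phi x))%:E + (l^-1 *
   (fine (phi x) - fine (phi y) - dot (grad phi y) (x - y)))%:E)%E.
  by apply: le_trans cf _; rewrite leeD2r.
rewrite -EFinD lee_fin !dotE; lra.
Qed.

(** Limits may leave X a priori; the minorant bounds phi along the sequence, so
    the limit stays in X, where f is lower semicontinuous. *)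
Lemma shifted_seq_lsc : seq_lsc F.
Proof.
have [g [c [k [k0 minor]]]] := shifted_minorant.
have [_ _ lp _] := dgf_coercive_lsc dphi cphi.
move=> z_ z a_ a cz ca Fz.
have Xz_ i : X (z_ i) by case/shifted_leP: (Fz i).
have lephi i : (phi (z_ i) <= (k^-1 * (a_ i - dot g (z_ i) - c))%:E)%E.
  rewrite (dgf_fineK dphi (Xz_ i)) lee_fin mulrC ler_pdivlMr // mulrC.
  by have := minor _ _ (Fz i); lra.
have Xz : X z.
  apply: (dgf_edom (b := k^-1 * (a - dot g z - c))).
  apply: (lp z_ z _ _ cz _ lephi); apply: cvgM; first exact: cvg_cst.
  apply: cvgB; last exact: cvg_cst.
  by apply: cvgB => //; apply: cvg_dot => //; exact: cvg_cst.
rewrite /shifted mem_set //; apply: (lsc_limit _ ca Fz) => b.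
rewrite -lteBlDr // -EFinB => bf.
have [p [fp bp]] : exists p, (p%:E < f z)%E /\ b - mu * fine (phi z) < p.
  move: bf; have := proper_gtNy Xz; case: (f z) => [r| |] // _.
    rewrite lte_fin => bf; exists ((b - mu * fine (phi z) + r) / 2).
    by rewrite lte_fin; split; lra.
  by exists (b - mu * fine (phi z) + 1); rewrite ltry; split=> //; lra.
have qp : (((b - p) / mu)%:E < phi z)%E.
  by rewrite (dgf_fineK dphi Xz) lte_fin ltr_pdivrMr //; lra.
have [_ lsc _ _ _] := dphi.
apply: filterS2 (lsc_on_near lf Xz Xz_ cz fp) (lsc_near lsc cz qp) => i fi.
rewrite (dgf_fineK dphi (Xz_ i)) lte_fin ltr_pdivrMr //= => qi.
rewrite /shifted mem_set // -lteBlDr // -EFinB; apply: lt_trans fi; rewrite lte_fin; lra.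
Qed.

Lemma shifted_coercive_lsc : coercive_lsc F.
Proof.
have [g [c [k [k0 minor]]]] := shifted_minorant.
have [_ _ _ sp] := dgf_coercive_lsc dphi cphi.
split; [exact: shifted_gtNy| |exact: shifted_seq_lsc|].
  have [_ [x Xx fx]] := pf; exists x, (fine (f x) + mu * fine (phi x)).
  apply/shifted_leP; split=> //; rewrite addrK fineK //.
  by have := proper_gtNy Xx; rewrite fin_numE; move: fx; case: (f x).
move=> K; have [c' Hc] := sp (k^-1 * (K + n%:R * `|g|)).
exists (k * c' - c) => z b Fz; have [Xz _] := iffLR (shifted_leP _ _) Fz.
have := minor _ _ Fz; have := Hc z (fine (phi z)).
rewrite -(dgf_fineK dphi Xz) lexx => /(_ isT) H.
have := ler_norm (- dot g z); rewrite normrN; have := normr_dot_le g z.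
have : K * `|z| + n%:R * `|g| * `|z| - k * c' <= k * fine (phi z).
  have := ler_wpM2l (ltW k0) H; rewrite mulrBr mulrA mulVKf ?gt_eqF //; lra.
lra.
Qed.

Lemma shifted_fineE x g : F x = g%:E -> X x /\ f x = (g - mu * fine (phi x))%:E.
Proof.
move=> Fx; have : (F x <= g%:E)%E by rewrite Fx.
move=> /shifted_leP[Xx _]; split=> //; move: Fx; rewrite /shifted mem_set //.
by case: (f x) => // r [<-]; rewrite addrK.
Qed.

Lemma shifted_finite x : X x -> (f x < +oo)%E ->
  F x = (fine (f x) + mu * fine (phi x))%:E.
Proof.
move=> Xx fx; rewrite /shifted mem_set // EFinD fineK //.
by have := proper_gtNy Xx; rewrite fin_numE; move: fx; case: (f x).
Qed.

(** Bregman distances to y differ from phi by an affine function of slope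
    - grad phi(y). *)
Lemma left_prox_supports y x : Y y ->
  left_prox phi lambda f y x <-> supports F (mu *: grad phi y) x.
Proof.
move=> Yy; set p := grad phi y; split=> [[_ Xx H]|sx].
- have fx : (f x < +oo)%E.
    have [_ [z Xz fz]] := pf; have := H z Xz; rewrite !bregmanE // -!EFinM.
    by move: fz; case: (f z) => [r| |] //; case: (f x) => [s| |] //; rewrite ?ltry.
  exists (fine (f x) + mu * fine (phi x)); first exact: shifted_finite.
  move=> z b /shifted_leP[Xz fz].
  have := le_trans (H z Xz) (leeD2r _ fz).
  rewrite !bregmanE // -!EFinM -EFinD.
  have := proper_gtNy Xx; move: fx; case: (f x) => [r| |] //= _ _.
  rewrite -/p -EFinD lee_fin !dotE; lra.
- have [g Fx H] := sx; have [Xx fx] := shifted_fineE Fx; split=> // z Xz.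
  rewrite !bregmanE // fx -!EFinM -EFinD.
  have := proper_gtNy Xz; case fz : (f z) => [r| |] // _; last first.
    by rewrite addye // leey.
  have := H z (r + mu * fine (phi z)); rewrite shifted_finite ?fz ?ltry //= lexx => /(_ isT).
  rewrite -EFinD lee_fin -/p !dotE; lra.
Qed.

Lemma svcomp_left_proxE : svcomp (left_prox phi lambda f) (nabla (conjugate phi)) =
  (fun u => supports F (mu *: u)).
Proof.
apply/funext => u; apply/seteqP; split=> x /=.
  move=> [y]; rewrite nabla_conjugate //= => sy.
  have Yy := supports_interior dphi lphi sy.
  by move/(left_prox_supports _ Yy); rewrite -(supports_grad dphi Yy sy).
move=> sx; have [y sy] := supports_exists u (dgf_coercive_lsc dphi cphi).
have Yy := supports_interior dphi lphi sy.
exists y; first by rewrite nabla_conjugate.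
by apply/(left_prox_supports _ Yy); rewrite -(supports_grad dphi Yy sy).
Qed.

Lemma level_subdiff_supports x u :
  level_subdiff phi lambda f x u <-> Y x /\ supports F (u + mu *: grad phi x) x.
Proof.
split=> [[Yx H]|[Yx sx]]; have Xx := interior_subset Yx.
- split=> //; have fx : (f x < +oo)%E.
    have [_ [z Xz fz]] := pf; have := H z Xz; rewrite !bregmanE // -!EFinM.
    by move: fz; case: (f z) => [r| |] //; case: (f x) => [s| |] //; rewrite ?ltry.
  exists (fine (f x) + mu * fine (phi x)); first exact: shifted_finite.
  move=> z b /shifted_leP[Xz fz].
  have := le_trans (H z Xz) fz; rewrite !bregmanE // -!EFinM.
  have := proper_gtNy Xx; move: fx; case: (f x) => [r| |] //= _ _.
  rewrite -!EFinD lee_fin !dotE; lra.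
- split=> // z Xz; have [g Fx H] := sx; have [_ fx] := shifted_fineE Fx.
  rewrite !bregmanE // fx -!EFinM -!EFinD.
  have := proper_gtNy Xz; case fz : (f z) => [r| |] // _; last by rewrite leey.
  have := H z (r + mu * fine (phi z)); rewrite shifted_finite ?fz ?ltry //= lexx => /(_ isT).
  rewrite lee_fin !dotE; lra.
Qed.

Lemma left_envE y : Y y -> left_env phi lambda f y =
  (mu * (dot (grad phi y) y - fine (phi y)) - fconj F (mu *: grad phi y))%:E.
Proof.
move=> Yy; have cF := shifted_coercive_lsc.
have [x sx] := supports_exists (mu *: grad phi y) cF.
have [g Fx _] := sx; have [Xx fx] := shifted_fineE Fx.
rewrite (fconj_supports shifted_gtNy sx Fx).
apply/eqP; rewrite eq_le; apply/andP; split.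
  apply: ereal_inf_lbound; exists x => //; rewrite bregmanE // fx -EFinM -EFinD.
  congr _%:E; rewrite !dotE; lra.
apply/ereal_infP => _ [z Xz <-]; have /(left_prox_supports _ Yy)[_ _ H] := sx.
apply: le_trans (H z Xz); rewrite bregmanE // fx -EFinM -EFinD lee_fin !dotE; lra.
Qed.

(** The slopes mu grad phi(y), y in Y, are all the vectors w, so the supremum
    defining the hull is the one defining the biconjugate. *)
Lemma hull_leP x a : X x ->
  (hull phi lambda f x <= a%:E)%E <->
  forall w, dot w x - fconj F w <= a + mu * fine (phi x).
Proof.
move=> Xx; rewrite /hull leeNl -EFinN; split.
- move=> H w; have [y sy] := supports_exists (lambda *: w) (dgf_coercive_lsc dphi cphi).
  have Yy := supports_interior dphi lphi sy.
  have gE := supports_grad dphi Yy sy.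
  have /(le_trans H) : (right_env phi lambda (fun y => - left_env phi lambda f y) x <=
      - left_env phi lambda f y + mu%:E * bregman phi x y)%E.
    by apply: ereal_inf_lbound; exists y.
  have -> : w = mu *: grad phi y by rewrite -gE scalerA mulVf ?gt_eqF // scale1r.
  rewrite left_envE // bregmanE // -EFinN -EFinM -EFinD lee_fin !dotE; lra.
- move=> H; apply/ereal_infP => _ [y Yy <-].
  rewrite left_envE // bregmanE // -EFinN -EFinM -EFinD lee_fin.
  have := H (mu *: grad phi y); rewrite !dotE; lra.
Qed.

(** The hull never exceeds f, by the Fenchel-Young inequality. *)
Lemma hull_eq_le_biconjugate :
  (forall x, X x -> f x = hull phi lambda f x) <-> le_biconjugate_on X F.
Proof.
split=> [H x a Xx xa|H x Xx].
  by apply/shifted_leP; split=> //; rewrite H //; apply/hull_leP => // w; rewrite subrK.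
have E b : (f x <= b%:E)%E <-> (hull phi lambda f x <= b%:E)%E.
  split=> [fb|/(hull_leP _ Xx)/(H x _ Xx)/shifted_leP[_]]; last by rewrite addrK.
  have Fx : (F x <= (b + mu * fine (phi x))%:E)%E.
    by apply/shifted_leP; rewrite addrK.
  apply/hull_leP => // w.
  by have := fenchel_young w shifted_coercive_lsc Fx; lra.
have := proper_gtNy Xx.
case: (f x) E => [r| |] // E _; case: (hull _ _ _ _) E => [h| |] // E.
- congr _%:E; apply/eqP; rewrite eq_le -!lee_fin; apply/andP.
  by split; [apply/(E h)|apply/(E r)].
- by have := iffLR (E r) (lexx _).
- by exfalso; have /iffRL/(_ (leNye _)) := E (r - 1); rewrite lee_fin; lra.
- by have := iffRL (E h) (lexx _).
- by have := iffRL (E 0) (leNye _).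
Qed.

Lemma convex_on_shifted :
  convex_on X (fun x => (f x + mu%:E * phi x)%E) <-> epi_convex F.
Proof.
have cX := dgf_edom_segment_closed dphi.
split=> [[_ H] x y a b t t01 Fx Fy|H].
  have [Xx _] := iffLR (shifted_leP _ _) Fx; have [Xy _] := iffLR (shifted_leP _ _) Fy.
  have Xm := cX _ _ _ t01 Xx Xy.
  rewrite shiftedE //; apply: le_trans (H x y t Xx Xy t01) _.
  rewrite -!shiftedE // [leRHS]EFinD !EFinM; have /andP[t0 t1] := t01.
  by rewrite leeD // lee_wpmul2l // lee_fin ?subr_ge0 ltW.
split; first exact/convex_setP.
move=> x y t Xx Xy t01; have Xm := cX _ _ _ t01 Xx Xy.
have /andP[t0 t1] := t01; have t1' : 0 < 1 - t by rewrite subr_gt0.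
rewrite -!shiftedE //.
have := shifted_gtNy x; have := shifted_gtNy y.
case Fx : (F x) => [a| |] //; case Fy : (F y) => [b| |] // _ _.
- by rewrite -!EFinM -EFinD; apply: H; rewrite ?Fx ?Fy.
- by rewrite gt0_muley ?lte_fin // -EFinM addey // leey.
- by rewrite gt0_muley ?lte_fin // -EFinM addye // leey.
- by rewrite !gt0_muley ?lte_fin // leey.
Qed.

Lemma convex_valued_shifted :
  convex_valued (fun u => supports F (mu *: u)) <->
  forall w, segment_closed (supports F w).
Proof.
split=> [H w|H u]; last exact/convex_setP.
have /convex_setP := H (lambda *: w).
by rewrite scalerA mulVf ?gt_eqF // scale1r.
Qed.

End BregmanProximity.

(** * Limiting subgradients at relative interior points *)

Section Subdifferentials.
Context {R : realType} {n : nat}.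
Local Notation V := 'rV[R]_n.
Variables (phi f : V -> \bar R) (lambda : R).
Local Notation X := (edom phi).
Local Notation Y := ((edom phi)°).
Hypotheses (dphi : dgf phi) (lphi : legendre phi) (cphi : one_coercive phi).
Hypotheses (pf : proper_on X f) (lf : lsc_on X f) (lambda0 : 0 < lambda).
Hypothesis (thr : (lambda%:E < prox_threshold phi f)%E).
Local Notation mu := (lambda^-1).
Local Notation F := (shifted phi f lambda).
Local Notation C := (X `&` edom f).
Implicit Types (x y z u w v d : V) (a b c r t : R).

Let mu0 : 0 < mu. Proof. by rewrite invr_gt0. Qed.

Lemma shifted_le_dom x b : (F x <= b%:E)%E -> C x.
Proof.
move=> /shifted_leP[Xx fx]; split=> //.
by rewrite /edom /= (le_lt_trans fx) ?ltry.
Qed.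

Lemma dom_fineK x : C x -> f x = (fine (f x))%:E.
Proof.
by move=> [Xx]; rewrite /edom /=; have := proper_gtNy pf Xx; case: (f x).
Qed.

(** F being convex and calm from above at x, it is calm from below: compare z
    with its mirror image 2 x - z. Subtracting mu phi, calm from above, leaves f
    calm from below. *)
Lemma relint_dom_calm x : epi_convex F -> relint C x -> exists2 r, 0 < r &
  exists2 L, 0 <= L & forall z, C z -> `|z - x| < r ->
    fine (f x) - L * `|z - x| <= fine (f z) /\
    fine (phi z) <= fine (phi x) + L * `|z - x|.
Proof.
move=> cF rx; have [Cx nearC] := rx; have [Xx fx] := Cx.
have Fx := shifted_finite lambda pf Xx fx; set g := _ + _ in Fx.
have Fxg : (F x <= g%:E)%E by rewrite Fx.
have [|r1 r10 [L1 H1]] := relint_calm rx cF Fxg.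
  by move=> z [Xz fz]; exists (fine (f z) + mu * fine (phi z)); rewrite shifted_finite.
have phix : (phi x <= (fine (phi x))%:E)%E by rewrite -dgf_fineK.
have [|r2 r20 [L2 H2]] := relint_calm rx (dgf_epi_convex dphi) phix.
  by move=> z [Xz _]; exists (fine (phi z)); rewrite -dgf_fineK.
exists (Num.min r1 r2); first by rewrite lt_min r10.
have L0 : 0 <= `|L1| + mu * `|L2| + `|L2| by rewrite !addr_ge0 // mulr_ge0 // ltW.
exists (`|L1| + mu * `|L2| + `|L2|) => // z Cz; rewrite lt_min => /andP[zr1 zr2].
have Az : aff C z by exact: sub_aff.
have := H2 z Az; rewrite distrC => /(_ zr2); have [Xz fz] := Cz.
rewrite (dgf_fineK dphi Xz) lee_fin => phiz.
have d0 := normr_ge0 (z - x).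
have l2 : L2 * `|z - x| <= `|L2| * `|z - x| by rewrite ler_wpM2r // ler_norm.
have l1 : L1 * `|z - x| <= `|L1| * `|z - x| by rewrite ler_wpM2r // ler_norm.
have m1 : 0 <= `|L1| * `|z - x| by rewrite mulr_ge0.
have m2 : 0 <= `|L2| * `|z - x| by rewrite mulr_ge0.
have m3 : 0 <= mu * (`|L2| * `|z - x|) by rewrite mulr_ge0 // ltW.
split; last by rewrite /= in phiz *; lra.
have Az' : aff C (2 *: x + (1 - 2) *: z) by apply: aff_affine => //; exact: sub_aff.
have := H1 _ Az'.
have -> : x - (2 *: x + (1 - 2) *: z) = z - x by apply/rowP => i; rewrite !mxE; ring.
have -> : 2 *: x + (1 - 2) *: z - x = - (z - x) by apply/rowP => i; rewrite !mxE; ring.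
rewrite normrN => /(_ zr1) Fz'.
have half : 0 < (2^-1 : R) < 1 by rewrite invr_gt0 ltr0n invf_lt1 ?ltr1n.
have Fz : (F z <= (fine (f z) + mu * fine (phi z))%:E)%E by rewrite shifted_finite.
have := cF _ _ _ _ _ half Fz' Fz.
have -> : 2^-1 *: (2 *: x + (1 - 2) *: z) + (1 - 2^-1) *: z = x.
  by apply/rowP => i; rewrite !mxE; field.
rewrite Fx lee_fin.
have := ler_wpM2l (ltW mu0) phiz; have := ler_wpM2l (ltW mu0) l2; rewrite /g; lra.
Qed.

(** The calmness of phi keeps phi, hence F, bounded along minimizing sequences in
    the ball, whose limits therefore remain in dom f. *)
Lemma penalized_min x r L K : relint C x -> 0 < r -> 0 < K ->
  (forall z, C z -> `|z - x| <= r -> fine (phi z) <= fine (phi x) + L * `|z - x|) ->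
  0 <= L ->
  exists z, [/\ C z, `|z - x| <= r & forall y, C y -> `|y - x| <= r ->
    fine (f z) + K / 2 * dot (z - x) (z - x) <=
    fine (f y) + K / 2 * dot (y - x) (y - x)].
Proof.
move=> [Cx _] r0 K0 HL L0.
pose D z := `|z - x| <= r.
pose h z : \bar R := if `[< C z >] && D z
  then (f z + (K / 2 * dot (z - x) (z - x))%:E)%E else +oo%E.
have hP z b : (h z <= b%:E)%E <-> [/\ C z, D z &
    (f z <= (b - K / 2 * dot (z - x) (z - x))%:E)%E].
  rewrite /h; case: ifPn => [/andP[/asboolP Cz Dz]|nz].
    by rewrite EFinB leeBrDr //; split=> [//|[]].
  rewrite leye_eq; split=> // -[Cz Dz _]; move: nz.
  by rewrite Dz andbT => /asboolP.
have [||||z [g hz minz]] := @attains_min R n h x (fine (f x)) (r + `|x|).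
- move=> z_ z a_ a cz ca Hz; have [_ _ lscF _] := shifted_coercive_lsc dphi cphi pf lf lambda0 thr.
  have cd : dot (z_ k - x) (z_ k - x) @[k --> \oo] --> dot (z - x) (z - x).
    by apply: cvg_dot; apply: cvgB => //; exact: cvg_cst.
  have cK : a_ k - K / 2 * dot (z_ k - x) (z_ k - x) @[k --> \oo] -->
      a - K / 2 * dot (z - x) (z - x).
    by apply: cvgB => //; apply: cvgM => //; exact: cvg_cst.
  have Cz : C z.
    apply: (@shifted_le_dom _ (a - K / 2 * dot (z - x) (z - x) + mu * (fine (phi x) + L * r))).
    apply: (lscF z_ z _ _ cz (cvgD cK (cvg_cst _))) => k.
    have /hP[Ck Dk fk] := Hz k; have [Xk _] := Ck.
    apply/shifted_leP; split=> //; apply: le_trans fk _; rewrite lee_fin.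
    have := HL _ Ck Dk; have := ler_wpM2l L0 Dk => A B.
    by have := ler_wpM2l (ltW mu0) (le_trans B (lerD (lexx _) A)); lra.
  apply/hP; split=> //.
    apply: (@ler_cvg _ (fun k => `|z_ k - x|) (fun=> r)); last first.
    + by move=> k; have /hP[] := Hz k.
    + exact: cvg_cst.
    + by apply: cvg_norm; apply: cvgB => //; exact: cvg_cst.
  have [Xz _] := Cz.
  apply: (lsc_on_limit lf Xz _ cz cK) => k; first by have /hP[[]] := Hz k.
  by have /hP[] := Hz k.
- move=> z; rewrite /h; case: ifP => // /andP[/asboolP Cz _].
  by rewrite (dom_fineK Cz) -EFinD ltNyr.
- by apply/hP; rewrite /D subrr normr0 dot0r mulr0 subr0 -dom_fineK // ltW.
- move=> z /hP[_ Dz _]; have := ler_normD (z - x) x; rewrite subrK.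
  by move=> /le_trans; apply; rewrite lerD2r.
have hzg : (h z <= g%:E)%E by rewrite hz.
have [Cz Dz _] := iffLR (hP z g) hzg; exists z; split=> // y Cy Dy.
have gE : g = fine (f z) + K / 2 * dot (z - x) (z - x).
  move: hz; rewrite /h Dz andbT; case: asboolP => // _.
  by rewrite (dom_fineK Cz) -EFinD => -[].
rewrite -gE; apply: (minz y); apply/hP; split=> //.
by rewrite addrK -dom_fineK.
Qed.

Lemma penalized_frechet x r K z : C z -> `|z - x| < r -> 0 < K ->
  (forall y, C y -> `|y - x| <= r ->
    fine (f z) + K / 2 * dot (z - x) (z - x) <=
    fine (f y) + K / 2 * dot (y - x) (y - x)) ->
  frechet_subdiff X f z (- K *: (z - x)).
Proof.
move=> Cz zr K0 minz; have [Xz _] := Cz.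
apply/frechet_subdiffP => [y Xy|]; first exact: (proper_gtNy pf Xy).
split=> //; exists (fine (f z)); first exact: dom_fineK.
move=> e e0; have D0 : 0 < K * n%:R + 1 by rewrite ltr_wpDl // mulr_ge0 // ltW.
have d0 : 0 < Num.min (r - `|z - x|) (e / (K * n%:R + 1)).
  by rewrite lt_min subr_gt0 zr divr_gt0.
apply: (ball_ex_near d0) => y; rewrite lt_min distrC => /andP[yr ye] Xy b fy.
have Cy : C y by split=> //; rewrite /edom /= (le_lt_trans fy) ?ltry.
have yb : fine (f y) <= b by rewrite -lee_fin -dom_fineK.
have := minz y Cy; have -> : y - x = (y - z) + (z - x).
  by apply/rowP => i; rewrite !mxE; ring.
have /[swap]/[apply] : `|y - z + (z - x)| <= r.
  by apply: le_trans (ler_normD _ _) _; lra.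
move: ye; rewrite ltr_pdivlMr // => ye.
have := le_trans (ler_norm _) (normr_dot_le (y - z) (y - z)).
move: (z - x) (y - z) ye => p q qe; rewrite !dotE (dotC q p) => dq.
have : K * dot q q <= e * `|q|.
  have := ler_wpM2l (ltW K0) dq; have := normr_ge0 q; nra.
have : 0 <= e * `|q| by rewrite mulr_ge0 // ltW.
lra.
Qed.

(** Calmness gives K |z - x| <= 2 L at the penalized minimizer z, so that the
    Frechet subgradients - K (z - x) stay bounded while z tends to x. *)
Lemma relint_limiting_nonempty x : epi_convex F -> relint C x ->
  limiting_subdiff X f x !=set0.
Proof.
move=> cF rx; have [Cx _] := rx; have [Xx fx] := Cx.
have [r2 r20 [L L0 HL]] := relint_dom_calm cF rx.
pose r := r2 / 2; have r0 : 0 < r by rewrite divr_gt0.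
have rr : r < r2 by rewrite /r; lra.
(* The term 2 L / r forces the minimizers into the open ball of radius r. *)
pose K k : R := k.+1%:R + 2 * L / r.
have K0 k : 0 < K k by rewrite ltr_wpDr // divr_ge0 ?mulr_ge0 // ltW.
have /choice[z_ Hz] k : exists z, [/\ C z, `|z - x| <= r & forall y, C y -> `|y - x| <= r ->
    fine (f z) + K k / 2 * dot (z - x) (z - x) <=
    fine (f y) + K k / 2 * dot (y - x) (y - x)].
  apply: (penalized_min rx r0 (K0 k) _ L0) => z Cz zr.
  by case: (HL z Cz (le_lt_trans zr rr)).
have Cz k : C (z_ k) by case: (Hz k).
have calm k : fine (f x) - L * `|z_ k - x| <= fine (f (z_ k)).
  by have [_ zr _] := Hz k; case: (HL _ (Cz k) (le_lt_trans zr rr)).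
have le_fx k : fine (f (z_ k)) + K k / 2 * dot (z_ k - x) (z_ k - x) <= fine (f x).
  have [_ _ /(_ x Cx)] := Hz k; rewrite subrr normr0 dot0r mulr0 addr0.
  by apply; exact: ltW.
have Kz k : K k * `|z_ k - x| <= 2 * L.
  have := calm k; have := le_fx k; have := sqr_norm_le_dot (z_ k - x).
  move=> /(ler_wpM2l (ltW (K0 k))); have := normr_ge0 (z_ k - x).
  move: (fine _) (fine _) (dot _ _) (K k) (K0 k) => p q s kk kk0.
  rewrite le_eqVlt => /orP[/eqP<- *|zx0 A B D]; first by rewrite mulr0; lra.
  by rewrite -(ler_pM2r zx0); nra.
have zr k : `|z_ k - x| < r.
  have [_ zr _] := Hz k; rewrite lt_neqAle zr andbT; apply/eqP => zE.
  have := Kz k; rewrite zE /K mulrDl divfK ?gt_eqF //.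
  have kr : 0 < k.+1%:R * r by rewrite mulr_gt0.
  by rewrite gerDr leNgt kr.
pose v_ k := - K k *: (z_ k - x).
have fv k : frechet_subdiff X f (z_ k) (v_ k).
  by have [_ _ mz] := Hz k; exact: penalized_frechet (zr k) (K0 k) mz.
have [k|h [v [hk cv]]] := @bolzano_weierstrass R n v_ (2 * L).
  by rewrite /v_ normrZ normrN gtr0_norm.
have cz : z_ k @[k --> \oo] --> x.
  apply/cvgrPdist_lt => e e0.
  have ch : 2 * L * harmonic k @[k --> \oo] --> (0 : R).
    by rewrite -(mulr0 (2 * L)); apply: cvgM; [exact: cvg_cst|exact: cvg_harmonic].
  apply: filterS (cvg_norm_near ch e0) => k; rewrite sub0r normrN distrC.
  move=> /(le_lt_trans (ler_norm _)); apply: le_lt_trans.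
  rewrite /harmonic /= ler_pdivlMr //; apply: le_trans (Kz k).
  rewrite mulrC ler_wpM2r // lerDl divr_ge0 ?mulr_ge0 // ltW //.
have cf : fine (f (z_ k)) @[k --> \oo] --> fine (f x).
  have cl : fine (f x) - L * `|z_ k - x| @[k --> \oo] --> fine (f x).
    rewrite -[X in _ --> X]subr0 -(mulr0 L) -(@normr0 _ V) -(subrr x).
    apply: cvgB; first exact: cvg_cst.
    apply: cvgM; first exact: cvg_cst.
    by apply: cvg_norm; apply: cvgB => //; exact: cvg_cst.
  apply: squeeze_cvgr cl (cvg_cst _); apply: nearW => k; rewrite calm /=.
  apply: le_trans (le_fx k); rewrite lerDl mulr_ge0 ?dot_ge0 //.
  by rewrite divr_ge0 // ltW.
exists v; split; [exact: Xx|exact: fx|exists (z_ \o h), (v_ \o h); split].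
- by move=> k; exact: fv.
- exact: (cvg_comp _ _ (geq_id_cvgny hk) cz).
- rewrite (dom_fineK Cx).
  have -> : (fun k => f ((z_ \o h) k)) = (EFin \o (fun k => fine (f (z_ (h k))))).
    by apply/funext => k /=; exact: dom_fineK.
  apply: cvg_EFin; first by apply: nearW.
  exact: (cvg_comp _ _ (geq_id_cvgny hk) cf).
- exact: cv.
Qed.

End Subdifferentials.

(** * The level subdifferential and the resolvent *)

Section LevelSubdifferential.
Context {R : realType} {n : nat}.
Local Notation V := 'rV[R]_n.
Variables (phi f : V -> \bar R) (lambda : R).
Local Notation X := (edom phi).
Local Notation Y := ((edom phi)°).
Hypotheses (dphi : dgf phi) (lphi : legendre phi) (cphi : one_coercive phi).
Hypotheses (pf : proper_on X f) (lf : lsc_on X f) (lambda0 : 0 < lambda).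
Hypothesis (thr : (lambda%:E < prox_threshold phi f)%E).
Local Notation mu := (lambda^-1).
Local Notation F := (shifted phi f lambda).
Local Notation C := (X `&` edom f).
Local Notation level := (level_subdiff phi lambda f).
Implicit Types (x y z u w v d : V) (a b c r t : R).

Let mu0 : 0 < mu. Proof. by rewrite invr_gt0. Qed.

Lemma frechet_supports x v : epi_convex F -> Y x -> frechet_subdiff X f x v ->
  supports F (v + mu *: grad phi x) x.
Proof.
move=> cF Yx /frechet_subdiffP[|Xx [g fx H]]; first exact: proper_gtNy.
apply: (local_supports (g := g + mu * fine (phi x))) => // [|e e0].
  by rewrite (shifted_finite lambda pf Xx) fx ?ltry.
apply: filterS (H e e0) => z Hz b /shifted_leP[Xz fz].
have := Hz Xz _ fz.
have := ler_wpM2l (ltW mu0) (dgf_supports_ineq dphi (grad_supports dphi Yx) Xz).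
rewrite dotDl dotZl; lra.
Qed.

Lemma level_frechet x v : level x v -> frechet_subdiff X f x v.
Proof.
move=> /(level_subdiff_supports lambda dphi pf _ _)[Yx [g Fx H]].
have [Xx fx] := shifted_fineE Fx.
apply/frechet_subdiffP; first exact: proper_gtNy.
split=> //; exists (g - mu * fine (phi x)) => // e e0.
have [_ _ _ _ dif] := dphi.
have le0 : 0 < lambda * e by rewrite mulr_gt0.
apply: filterS (grad_approx (dif x Yx) le0) => z Hz Xz b fz.
have Fz : (F z <= (b + mu * fine (phi z))%:E)%E by apply/shifted_leP; rewrite addrK.
have := H _ _ Fz; move: Hz; rewrite ler_norml => /andP[_].
move=> /(ler_wpM2l (ltW mu0)); rewrite !mulrA mulVf ?gt_eqF // mul1r.
rewrite dotDl dotZl; lra.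
Qed.

Lemma limiting_level x : epi_convex F -> Y x -> limiting_subdiff X f x = level x.
Proof.
move=> cF Yx; apply/seteqP; split=> v; last by move/level_frechet/frechet_limiting.
move=> [Xx fx [x_ [v_ [fv cx _ cv]]]].
have [N YN] := near_cvg_seq cx (near_interior Yx).
have cxN : x_ (k + N)%N @[k --> \oo] --> x by rewrite (@cvg_shiftn N _ x_).
have [h hk cg] := grad_continuous dphi cphi Yx YN cxN.
have hN k : (k <= h k + N)%N by rewrite (leq_trans (hk k)) // leq_addr.
apply/(level_subdiff_supports lambda dphi pf _ _); split=> //.
apply: (supports_closed (shifted_coercive_lsc dphi cphi pf lf lambda0 thr)
  (w_ := fun k => v_ (h k + N)%N + mu *: grad phi (x_ (h k + N)%N))
  (z_ := fun k => x_ (h k + N)%N)).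
- apply: cvgD; first exact: (cvg_comp _ _ (geq_id_cvgny hN) cv).
  by apply: cvgZl_tmp; exact: cg.
- exact: (cvg_comp _ _ (geq_id_cvgny hN) cx).
- by move=> k; apply: frechet_supports => //; exact: YN.
Qed.

Lemma convex_hull_dom_sub : convex_hull C `<=` X.
Proof. by apply: convex_hull_sub => [x []//|]; exact: dgf_edom_segment_closed. Qed.

(** A subgradient at s x0 + (1 - s) m, with m = t x + (1 - t) y, evaluated at x0,
    x and y with weights s, (1 - s) t and (1 - s)(1 - t), has its linear terms
    cancel. *)
Lemma level_epi_convex x0 : relint (convex_hull C) x0 -> Y x0 ->
  relint (convex_hull C) `&` Y `<=` svdom level -> epi_convex F.
Proof.
move=> rx0 Yx0 sub x y a b t t01 Fx Fy; set m := _ + _.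
have hC : segment_closed (convex_hull C) by exact: convex_hull_segment_closed.
have Cm : convex_hull C m.
  by apply: hC => //; apply: sub_convex_hull; [exact: shifted_le_dom Fx|exact: shifted_le_dom Fy].
have Xm := convex_hull_dom_sub Cm.
have level_supp z : relint (convex_hull C) z -> Y z -> exists w, supports F w z.
  move=> rz Yz; have [u] := sub z (conj rz Yz).
  by move=> /(level_subdiff_supports lambda dphi pf _ _)[_ su]; exists (u + mu *: grad phi z).
(* A point with a level subgradient has a finite value. *)
have [w0 [c Fx0 _]] := level_supp x0 rx0 Yx0.
have {}Fx0 : (F x0 <= c%:E)%E by rewrite Fx0.
pose s k : R := k.+2%:R^-1.
have s01 k : 0 < s k < 1 by rewrite /s invr_gt0 ltr0n invf_lt1 ?ltr1n.
have [_ _ lF _] := shifted_coercive_lsc dphi cphi pf lf lambda0 thr.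
have cs := @cvg_harmonicS R.
have cs1 : 1 - s k @[k --> \oo] --> (1 : R).
  by rewrite -[X in _ --> X]subr0; apply: cvgB => //; exact: cvg_cst.
set d := t * a + _.
apply: (lF (fun k => s k *: x0 + (1 - s k) *: m) m (fun k => s k * c + (1 - s k) * d)).
- rewrite -[X in _ --> X](_ : 0 *: x0 + 1 *: m = m); last by rewrite scale0r add0r scale1r.
  by apply: cvgD; exact: cvgZr_tmp.
- rewrite -[X in _ --> X](_ : 0 * c + 1 * d = d); last by rewrite mul0r add0r mul1r.
  by apply: cvgD; apply: cvgM => //; exact: cvg_cst.
move=> k; have [||w [g Fm H]] := level_supp (s k *: x0 + (1 - s k) *: m) _ _.
- exact: relint_segment.
- exact: (interior_segment (dgf_edom_segment_closed dphi) Yx0 Xm (s01 k)).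
rewrite Fm lee_fin; have := H _ _ Fx0; have := H _ _ Fx; have := H _ _ Fy.
have /andP[s0 s1] := s01 k; have /andP[t0 t1] := t01.
rewrite /m /d !dotE; move: (s k) s0 s1 => q q0 q1 A0 B0 D0.
have {}B0 := ler_wpM2l (ltW t0) B0.
have t1' : 0 <= 1 - t by rewrite subr_ge0 ltW.
have {}A0 := ler_wpM2l t1' A0.
have q1' : 0 <= 1 - q by rewrite subr_ge0 ltW.
have AB := ler_wpM2l q1' (lerD B0 A0); have {}D0 := ler_wpM2l (ltW q0) D0.
lra.
Qed.

Lemma relint_interior_exists z : C z -> Y z ->
  exists2 x, relint (convex_hull C) x & Y x.
Proof.
move=> Cz Yz; have hC : segment_closed (convex_hull C) by exact: convex_hull_segment_closed.
have hz : convex_hull C z by exact: sub_convex_hull.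
have [x0 rx0] := relint_nonempty hC (ex_intro _ z hz).
have [r /andP[r0 r1] Hr] := near_segment x0 (near_interior Yz).
exists (r *: x0 + (1 - r) *: z); last by apply: Hr; rewrite r0 lexx.
by apply: relint_segment => //; rewrite r0 r1.
Qed.

Lemma dom_nonempty : exists z, C z.
Proof. by have [_ [z Xz fz]] := pf; exists z. Qed.

(** In terms of F both sides say that mu grad phi(y) is a subgradient at x,
    once limiting and level subgradients are identified. *)
Lemma left_prox_resolvent y x : epi_convex F -> Y x ->
  left_prox phi lambda f y x <->
  svcomp (svinv (svadd (nabla phi) (svscale lambda (limiting_subdiff X f)))) (nabla phi) y x.
Proof.
move=> cF Yx; split=> [px|[_ [Yy ->] [_ [_ ->] [_ [v vx <-]] gy]]].
  have [Yy _ _] := px; have sx := iffLR (left_prox_supports lambda dphi pf x Yy) px.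
  exists (grad phi y) => //; exists (grad phi x) => //.
  exists (grad phi y - grad phi x); last by rewrite addrC subrK.
  exists (mu *: (grad phi y - grad phi x)); last by rewrite scalerA divff ?gt_eqF // scale1r.
  rewrite limiting_level //; apply/(level_subdiff_supports lambda dphi pf _ _); split=> //.
  by rewrite -scalerDr subrK.
apply/(left_prox_supports lambda dphi pf x Yy).
move: vx; rewrite limiting_level // => /(level_subdiff_supports lambda dphi pf _ _)[_].
by rewrite -gy scalerDr scalerA mulVf ?gt_eqF // scale1r addrC.
Qed.

(** Let y have gradient grad phi(x) + lambda v. The resolvent formula makes x a
    prox point of y, which is the level inequality for v. *)
Lemma resolvent_level x v : Y x -> limiting_subdiff X f x v ->
  (forall y, left_prox phi lambda f y =
     svcomp (svinv (svadd (nabla phi) (svscale lambda (limiting_subdiff X f)))) (nabla phi) y) ->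
  level x v.
Proof.
move=> Yx vx res; have [y sy] := supports_exists (grad phi x + lambda *: v)
  (dgf_coercive_lsc dphi cphi).
have Yy := supports_interior dphi lphi sy; have gy := supports_grad dphi Yy sy.
apply/(level_subdiff_supports lambda dphi pf _ _); split=> //.
have -> : v + mu *: grad phi x = mu *: grad phi y.
  by rewrite -gy scalerDr scalerA mulVf ?gt_eqF // scale1r addrC.
apply/(left_prox_supports lambda dphi pf x Yy); rewrite res.
exists (grad phi y) => //; exists (grad phi x) => //; exists (lambda *: v) => //.
by exists v.
Qed.

(** Prox points exist, and the resolvent, which involves grad phi at them, only
    contains points of Y. *)
Lemma resolvent_dom_interior :
  (forall y, left_prox phi lambda f y =
     svcomp (svinv (svadd (nabla phi) (svscale lambda (limiting_subdiff X f)))) (nabla phi) y) ->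
  exists2 z, C z & Y z.
Proof.
move=> res; have [_ _ _ [y Yy] _] := dphi.
have [z sz] := supports_exists (mu *: grad phi y)
  (shifted_coercive_lsc dphi cphi pf lf lambda0 thr).
have [g Fz _] := sz; exists z.
  by apply: (@shifted_le_dom R n phi f lambda _ g); rewrite Fz.
have : left_prox phi lambda f y z by apply/(left_prox_supports lambda dphi pf z Yy).
by rewrite res => -[_ _ [_ [Yz _] _]].
Qed.

End LevelSubdifferential.

Theorem theorem4p5 (R : realType) (n : nat) (phi f : 'rV[R]_n -> \bar R)
    (lambda : R) :
  let X := edom phi in
  let subdiff_f := limiting_subdiff X f in
  let level_f := level_subdiff phi lambda f in
  let prox_f := left_prox phi lambda f in
  let ri_f := relint (convex_hull (X `&` edom f)) in
  dgf phi -> legendre phi -> one_coercive phi ->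
  proper_on X f -> lsc_on X f -> prox_bounded phi f ->
  0 < lambda -> (lambda%:E < prox_threshold phi f)%E ->
  let Sa := convex_on X (fun x => (f x + lambda^-1%:E * phi x)%E) in
  let Sb := forall x, X x -> f x = hull phi lambda f x in
  let Sc := maximally_monotone (svcomp prox_f (nabla (conjugate phi))) in
  let Sd := convex_valued (svcomp prox_f (nabla (conjugate phi))) in
  let Se := ri_f `<=` svdom subdiff_f /\
            (forall x, X° x -> subdiff_f x = level_f x) in
  let Sf := ri_f `&` X° `<=` svdom level_f in
  let Sg := ri_f `<=` svdom subdiff_f /\
            (forall y, prox_f y =
               svcomp (svinv (svadd (nabla phi) (svscale lambda subdiff_f)))
                      (nabla phi) y) in
  [/\ Sg -> Sa, Sa <-> Sb, Sb <-> Sc, Sc <-> Sd & Sd -> Se] /\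
  (Se -> Sf) /\
  (ri_f `<=` X° -> (Sf -> Sa) /\ (svrange prox_f `<=` X° -> Sa -> Sg)).
Proof.
move=> X subdiff_f level_f prox_f ri_f dphi lphi cphi pf lf _ lambda0 thr.
move=> Sa Sb Sc Sd Se Sf Sg.
have cF := shifted_coercive_lsc dphi cphi pf lf lambda0 thr.
have Fny := shifted_gtNy lambda pf.
have SaE : Sa <-> epi_convex (shifted phi f lambda).
  exact: convex_on_shifted.
have SbE : Sb <-> le_biconjugate_on X (shifted phi f lambda).
  exact: hull_eq_le_biconjugate.
have mu0 : 0 < lambda^-1 by rewrite invr_gt0.
have TE : svcomp prox_f (nabla (conjugate phi)) =
    (fun u => supports (shifted phi f lambda) (lambda^-1 *: u)).
  exact: svcomp_left_proxE.
have SdE : Sd <-> forall w, segment_closed (supports (shifted phi f lambda) w).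
  by rewrite /Sd TE; exact: convex_valued_shifted.
have ad : Sa -> Sd.
  by move=> /SaE sa; apply/SdE => w; exact: epi_convex_supports.
have db : Sd -> Sb by move=> /SdE sd; apply/SbE; exact: supports_le_biconjugate.
have ba : Sb -> Sa.
  move=> /SbE sb; apply/SaE; apply: le_biconjugate_epi_convex cF _ sb.
    by move=> x b /shifted_leP[].
  exact: dgf_edom_segment_closed.
have cd : Sc -> Sd.
  by move=> sc u; apply/convex_setP; exact: maximal_segment_closed.
have dc : Sd -> Sc.
  by move=> /SdE sd; rewrite /Sc TE; exact: supports_maximally_monotone.
have ri_dom : Sa -> ri_f `<=` svdom subdiff_f.
  move=> /SaE sa x; have cC : segment_closed (X `&` edom f).
    move=> y z t t01 [Xy fy] [Xz fz].
    apply: (@shifted_le_dom R n phi f lambda _ (t * (fine (f y) + lambda^-1 * fine (phi y)) +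
      (1 - t) * (fine (f z) + lambda^-1 * fine (phi z)))).
    by apply: sa => //; rewrite shifted_finite.
  rewrite /ri_f convex_hull_id // => rx.
  exact: (relint_limiting_nonempty dphi cphi pf lf lambda0 thr sa rx).
have fa z : ri_f z -> X° z -> Sf -> Sa.
  by move=> rz Yz sf; apply/SaE; exact: level_epi_convex rz Yz sf.
split; [split|split].
- move=> [gdom res].
  have [z Cz Yz] := resolvent_dom_interior dphi cphi pf lf lambda0 thr res.
  have [x rx Yx] := relint_interior_exists Cz Yz.
  apply: fa rx Yx _ => y [/gdom[v vy] Yy]; exists v.
  exact: (resolvent_level dphi lphi cphi pf lambda0 Yy vy res).
- by split=> // /ad.
- by split=> [/ba/ad|/cd].
- by split.
- move=> sd; have sa := ba (db sd); split; first exact: ri_dom.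
  by move=> x Yx; apply: limiting_level => //; exact/SaE.
- by move=> [edom eqE] x [/edom[v vx] Yx]; exists v; rewrite -(eqE x Yx).
move=> riY; split.
  have [z Cz] := dom_nonempty pf.
  have hC := @convex_hull_segment_closed R n (X `&` edom f).
  have [x rx] := relint_nonempty hC (ex_intro _ z (sub_convex_hull Cz)).
  exact: fa rx (riY x rx).
move=> rangeY sa; split; first exact: ri_dom.
move=> y; apply/seteqP; split=> x.
  move=> px; apply/left_prox_resolvent => //; first exact/SaE.
  by apply: rangeY; exists y.
move=> rx; have [_ _ [_ [Yx _] _]] := rx.
by apply/left_prox_resolvent => //; exact/SaE.
Qed.
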